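(* Let $\Gamma$ be a distance-regular graph with vertex set $X$ and diameter $D\ge 3$, let $\{E_i\}_{i=0}^D$ be a $Q$-polynomial ordering of its primitive idempotents, let $x\in X$, and let $T^{\mathbb{R}}=T^{\mathbb{R}}(x)$ and $T^{\mathbb{C}}=T^{\mathbb{C}}(x)$ be the Terwilliger algebras of $\Gamma$ with respect to $x$ over $\mathbb{R}$ and over $\mathbb{C}$. Let $$T^{\mathbb{C}}\cong\bigoplus_{i=1}^{h}\mathrm{Mat}_{n_i}(\mathbb{C})\qquad\text{and}\qquad T^{\mathbb{R}}\cong\bigoplus_{i=1}^{\ell}\mathrm{Mat}_{m_i}(\mathbb{D}_i)$$ be the Wedderburn decompositions of $T^{\mathbb{C}}$ (as a $\mathbb{C}$-algebra) and of $T^{\mathbb{R}}$ (as an $\mathbb{R}$-algebra), where $h,n_1,\dots,n_h,\ell,m_1,\dots,m_\ell$ are positive integers and each $\mathbb{D}_i$ is one of $\mathbb{R}$, $\mathbb{C}$, $\mathbb{H}$. Then $\ell=h$, and, after a suitable reordering of the summands, $m_i=n_i$ and $\mathbb{D}_i=\mathbb{R}$ for $1\le i\le\ell$.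
   Context: $\Gamma$ is a finite, undirected, connected graph without loops or multiple edges, with vertex set $X$, path-length distance $\partial$ and diameter $D=\max\{\partial(y,z)\mid y,z\in X\}$. It is distance-regular: for all $0\le h,i,j\le D$ and all $y,z\in X$ with $\partial(y,z)=h$, the number $p^h_{i,j}=|\{w\in X\mid \partial(y,w)=i,\ \partial(z,w)=j\}|$ depends only on $h,i,j$. All matrices have rows and columns indexed by $X$. The adjacency matrix $A$ has $D+1$ distinct real eigenvalues $\theta_0,\dots,\theta_D$, with $\theta_0$ equal to the valency; the primitive idempotent $E_i$ is the matrix of the orthogonal projection onto the $\theta_i$-eigenspace of $A$. With $\circ$ the entrywise product, the Krein parameters $q^h_{i,j}$ are defined by $E_i\circ E_j=|X|^{-1}\sum_{h=0}^D q^h_{i,j}E_h$. The ordering $\{E_i\}_{i=0}^D$ is $Q$-polynomial if for all $0\le h,i,j\le D$: $q^h_{i,j}=0$ whenever one of $h,i,j$ is greater than the sum of the other two, and $q^h_{i,j}\ne0$ whenever one of $h,i,j$ equals the sum of the other two. For $0\le i\le D$, $E_i^*=E_i^*(x)$ is the diagonal matrix with $(y,y)$-entry $1$ if $\partial(x,y)=i$ and $0$ otherwise. For $\mathbb{F}\in\{\mathbb{R},\mathbb{C}\}$, the Terwilliger algebra $T^{\mathbb{F}}$ is the $\mathbb{F}$-subalgebra of the algebra $\mathrm{Mat}_X(\mathbb{F})$ of matrices with entries in $\mathbb{F}$ generated by $A$ and $E_0^*,\dots,E_D^*$. It is closed under conjugate transpose and hence semisimple, so it has a Wedderburn decomposition.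 Here $\mathrm{Mat}_n(\mathbb{D})$ is the algebra of $n\times n$ matrices over $\mathbb{D}$ and $\mathbb{H}$ denotes the real quaternions. *)

(* Defs.v *)
From HB Require Import structures.
From mathcomp Require Import all_boot all_order all_algebra.
From mathcomp Require Import reals complex.
From mathcomp Require Import ring.

Set Implicit Arguments.
Unset Strict Implicit.
Unset Printing Implicit Defensive.

Import Order.TTheory GRing.Theory Num.Theory.
Local Open Scope ring_scope.

Section Graph.
Variables (X : finType) (e : rel X).

Definition walk (n : nat) (y z : X) : bool :=
  [exists p : n.-tuple X, path e y p && (last y p == z)].

(* The least n < #|X| such that a walk of length n joins y and z; the junk
   value #|X| only occurs when y and z are not connected. *)
Definition dist (y z : X) : nat := find (fun n => walk n y z) (iota 0 #|X|).

Definition diameter : nat := \max_(yz : X * X) dist yz.1 yz.2.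

Definition connected_simple_graph : Prop :=
  [/\ symmetric e, irreflexive e & forall y z, connect e y z].

Definition pcount (i j : nat) (y z : X) : nat :=
  #|[set w | (dist y w == i) && (dist z w == j)]|.

Definition distance_regular : Prop :=
  connected_simple_graph /\
  forall h i j : 'I_diameter.+1, exists p : nat,
    forall y z : X, dist y z = h -> pcount i j y z = p.

(* Matrices indexed by X are encoded as matrices of size #|X|, through the
   bijection enum_val : 'I_#|X| -> X. *)
Definition adjmx (F : pzRingType) : 'M[F]_#|X| :=
  \matrix_(u, v) (e (enum_val u) (enum_val v))%:R.

Definition dual_idem (F : pzRingType) (x : X) (i : nat) : 'M[F]_#|X| :=
  \matrix_(u, v) ((u == v) && (dist x (enum_val u) == i))%:R.

End Graph.

(* Orthogonal projection onto the row space of U, acting on row vectors;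
   kermx U^T is the orthogonal complement of that row space. *)
Definition orth_proj (R : realFieldType) (m n : nat) (U : 'M[R]_(m, n)) :
    'M[R]_n :=
  proj_mx <<U>>%MS (kermx U^T).

Section QPolynomial.
Variables (R : realFieldType) (X : finType) (e : rel X).

Local Notation D := (diameter e).

(* adjmx e R is symmetric, so its (row) eigenspaces, and the orthogonal
   projections onto them, do not depend on the row / column convention. *)
Definition prim_idem (theta : 'I_D.+1 -> R) (i : 'I_D.+1) : 'M[R]_#|X| :=
  orth_proj (eigenspace (adjmx e R) (theta i)).

Definition eigenvalue_ordering (theta : 'I_D.+1 -> R) : Prop :=
  [/\ injective theta,
      forall a : R, eigenvalue (adjmx e R) a <-> exists i, a = theta i &
      forall y : X, theta ord0 = #|[set z | e y z]|%:R].

Definition krein_parameters (E : 'I_D.+1 -> 'M[R]_#|X|)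
    (q : 'I_D.+1 -> 'I_D.+1 -> 'I_D.+1 -> R) : Prop :=
  forall i j, map2_mx *%R (E i) (E j) = #|X|%:R^-1 *: \sum_h q h i j *: E h.

Definition Q_polynomial (E : 'I_D.+1 -> 'M[R]_#|X|) : Prop :=
  exists q, krein_parameters E q /\
  forall h i j : 'I_D.+1,
    ([|| i + j < h, h + j < i | h + i < j]%N -> q h i j = 0) /\
    ([|| h == i + j :> nat, i == h + j :> nat | j == h + i :> nat]%N ->
       q h i j != 0).

End QPolynomial.

Section Subalgebra.
Variables (F : comNzRingType) (n : nat).

Inductive gen_subalg (S : 'M[F]_n -> Prop) : 'M[F]_n -> Prop :=
| gen_subalg_gen M : S M -> gen_subalg S M
| gen_subalg1 : gen_subalg S 1%:M
| gen_subalgD M N : gen_subalg S M -> gen_subalg S N -> gen_subalg S (M + N)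
| gen_subalgZ a M : gen_subalg S M -> gen_subalg S (a *: M)
| gen_subalgM M N : gen_subalg S M -> gen_subalg S N -> gen_subalg S (M *m N).

End Subalgebra.

Definition terwilliger (F : comNzRingType) (X : finType) (e : rel X) (x : X) :
    'M[F]_#|X| -> Prop :=
  gen_subalg (fun M => M = adjmx e F \/
    exists i : 'I_(diameter e).+1, M = dual_idem e F x i).
Arguments terwilliger F {X} e x.

(* The subalgebra T of 'M[F]_N is isomorphic, as an F-algebra, to the direct
   sum of the 'M[K i]_(m i) for i < k. Here f i is the i-th component of the
   isomorphism; its values outside of T are irrelevant. *)
Definition iso_mx_sum (F : comNzRingType) (N : nat) (T : 'M[F]_N -> Prop)
    (k : nat) (m : 'I_k -> nat) (K : 'I_k -> algType F) : Prop :=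
  exists f : forall i : 'I_k, 'M[F]_N -> 'M[K i]_(m i),
  [/\ forall i, f i 1%:M = 1%:M,
      forall i a A B, T A -> T B ->
        f i (a *: A + B) = map_mx ( *:%R a) (f i A) + f i B,
      forall i A B, T A -> T B -> f i (A *m B) = f i A *m f i B,
      forall A B, T A -> T B -> (forall i, f i A = f i B) -> A = B &
      forall G : (forall i, 'M[K i]_(m i)),
        exists2 A, T A & forall i, f i A = G i].

(* Quat a b c d is a + b i + c j + d k. *)
Record quaternion (R : Type) : Type :=
  Quat { qr : R; qi : R; qj : R; qk : R }.

Section Quaternion.
Variable R : comNzRingType.
Local Notation H := (quaternion R).

Definition quat_tuple (x : H) : R * R * R * R := (qr x, qi x, qj x, qk x).
Definition tuple_quat (t : R * R * R * R) : H :=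
  let: (a, b, c, d) := t in Quat a b c d.
Lemma quat_tupleK : cancel quat_tuple tuple_quat. Proof. by case. Qed.

HB.instance Definition _ := Choice.copy H (can_type quat_tupleK).

Definition quat0 : H := Quat 0 0 0 0.
Definition quat1 : H := Quat 1 0 0 0.
Definition quat_opp (x : H) : H := Quat (- qr x) (- qi x) (- qj x) (- qk x).
Definition quat_add (x y : H) : H :=
  Quat (qr x + qr y) (qi x + qi y) (qj x + qj y) (qk x + qk y).
Definition quat_scale (a : R) (x : H) : H :=
  Quat (a * qr x) (a * qi x) (a * qj x) (a * qk x).
Definition quat_mul (x y : H) : H :=
  Quat (qr x * qr y - qi x * qi y - qj x * qj y - qk x * qk y)
       (qr x * qi y + qi x * qr y + qj x * qk y - qk x * qj y)
       (qr x * qj y - qi x * qk y + qj x * qr y + qk x * qi y)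
       (qr x * qk y + qi x * qj y - qj x * qi y + qk x * qr y).

Local Ltac quat_ring :=
  repeat case=> ? ? ? ?; rewrite /quat_mul /quat_add /quat_opp /quat_scale /=;
  congr Quat; ring.

Fact quat_addA : associative quat_add. Proof. quat_ring. Qed.
Fact quat_addC : commutative quat_add. Proof. quat_ring. Qed.
Fact quat_add0 : left_id quat0 quat_add. Proof. quat_ring. Qed.
Fact quat_addN : left_inverse quat0 quat_opp quat_add. Proof. quat_ring. Qed.
HB.instance Definition _ :=
  GRing.isZmodule.Build H quat_addA quat_addC quat_add0 quat_addN.

Fact quat_mulA : associative quat_mul. Proof. quat_ring. Qed.
Fact quat_mul1l : left_id quat1 quat_mul. Proof. quat_ring. Qed.
Fact quat_mul1r : right_id quat1 quat_mul. Proof. quat_ring. Qed.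
Fact quat_mulDl : left_distributive quat_mul quat_add. Proof. quat_ring. Qed.
Fact quat_mulDr : right_distributive quat_mul quat_add. Proof. quat_ring. Qed.
Fact quat1_neq0 : quat1 != 0.
Proof. by apply/eqP => -[] /eqP; rewrite oner_eq0. Qed.
HB.instance Definition _ := GRing.Zmodule_isNzRing.Build H
  quat_mulA quat_mul1l quat_mul1r quat_mulDl quat_mulDr quat1_neq0.

Fact quat_scaleA a b (v : H) :
  quat_scale a (quat_scale b v) = quat_scale (a * b) v.
Proof. move: v; quat_ring. Qed.
Fact quat_scale1 : left_id 1 quat_scale. Proof. move=> v; move: v; quat_ring. Qed.
Fact quat_scaleDr : right_distributive quat_scale +%R.
Proof. move=> a [? ? ? ?] [? ? ? ?]; rewrite /quat_scale /=; congr Quat; exact: mulrDr. Qed.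
Fact quat_scaleDl (v : H) : {morph quat_scale^~ v : a b / a + b}.
Proof. move=> a b; case: v => ? ? ? ?; congr Quat; exact: mulrDl. Qed.
HB.instance Definition _ := GRing.Zmodule_isLmodule.Build R H
  quat_scaleA quat_scale1 quat_scaleDr quat_scaleDl.

Fact quat_scaleAl (a : R) (u v : H) : a *: (u * v) = a *: u * v.
Proof.
change (quat_scale a (quat_mul u v) = quat_mul (quat_scale a u) v).
move: u v; quat_ring.
Qed.
HB.instance Definition _ := GRing.Lmodule_isLalgebra.Build R H quat_scaleAl.

Fact quat_scaleAr (a : R) (u v : H) : a *: (u * v) = u * (a *: v).
Proof.
change (quat_scale a (quat_mul u v) = quat_mul u (quat_scale a v)).
move: u v; quat_ring.
Qed.
HB.instance Definition _ := GRing.Lalgebra_isAlgebra.Build R H quat_scaleAr.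

End Quaternion.

(* Rcomplex R is R[i] as an algebra over R; the library only provides its
   left algebra structure. *)
Section RcomplexAlgebra.
Variable R : realFieldType.

Fact Rcomplex_scaleAr (a : R) (u v : Rcomplex R) : a *: (u * v) = u * (a *: v).
Proof. by rewrite mulrC scalerAl mulrC. Qed.
HB.instance Definition _ :=
  GRing.Lalgebra_isAlgebra.Build R (Rcomplex R) Rcomplex_scaleAr.

End RcomplexAlgebra.

Variant real_div_alg : Type := RealAlg | ComplexAlg | QuaternionAlg.

Definition real_div_alg_sort (R : realType) (d : real_div_alg) : algType R :=
  match d with
  | RealAlg => R^o
  | ComplexAlg => Rcomplex R
  | QuaternionAlg => quaternion R
  end.

(* Main.v *)
(* The diagonal matrix A^* with (y, y)-entry proportional to (E_1)_{xy} is a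
   combination of the E_k^* with distinct coefficients, and both
   E_i (A^* )^t E_j and E_i^* A^t E_j^* vanish for t < |i - j|.

   Let z be the unit of a simple block of T^R, r the least index with
   E_r^* z <> 0, and e = E_r^* z. Since
   F_k(i,j) = e E_i E_k^* E_j e - e E_j E_k^* E_i e is killed by all polynomials
   of degree < k - r in theta_j and, summed against polynomials of degree
   < |i - j| in theta_k^*, vanishes too, eliminating from the largest k downwards
   gives F = 0; for k = r this says that the matrices e E_i e commute. A similar
   elimination shortens the words e A^a (A^* )^b A^c ... e until they are products
   of the e E_i e. As these are commuting symmetric matrices, every element of
   e T^R e is symmetric.

   If the division algebra of the block were C or H, then e T^R e would contain
   symmetric u <> 0 and v with u^2 = u and v^2 = - u, contradicting
   tr (v v^T) >= 0. So every block of T^R is a matrix algebra over R. Finally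
   T^C = T^R + i T^R has the same central primitive idempotents as T^R, and
   corresponding blocks have equal dimensions. *)
Require Import Defs.
From HB Require Import structures.
From mathcomp Require Import all_boot all_order all_algebra.
From mathcomp Require Import reals complex.
From mathcomp Require Import zify ring lra.

Set Implicit Arguments.
Unset Strict Implicit.
Unset Printing Implicit Defensive.

Import Order.TTheory GRing.Theory Num.Theory.
Local Open Scope ring_scope.

(** * Elimination by moment conditions *)

(** One notion of subspace for every elimination below: vanishing, being symmetric and commuting
    with the corner, agreeing at two entries. *)
Definition lin_closed (F : nzRingType) (V : lmodType F) (Q : V -> Prop) :=
  Q 0 /\ forall a u v, Q u -> Q v -> Q (a *: u + v).

Section LinClosed.
Variables (F : fieldType) (V : lmodType F) (Q : V -> Prop).
Hypothesis Q_lin : lin_closed Q.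

Lemma lin_closed0 : Q 0. Proof. by case: Q_lin. Qed.

Lemma lin_closedZ a u : Q u -> Q (a *: u).
Proof. by case: Q_lin => Q0 QD Qu; rewrite -[_ *: _]addr0; apply: QD. Qed.

Lemma lin_closedD u v : Q u -> Q v -> Q (u + v).
Proof. by case: Q_lin => _ QD Qu Qv; rewrite -[u]scale1r; apply: QD. Qed.

Lemma lin_closedB u v : Q u -> Q v -> Q (u - v).
Proof.
by move=> Qu Qv; apply: lin_closedD => //; rewrite -scaleN1r; apply: lin_closedZ.
Qed.

Lemma lin_closed_sum (I : Type) (r : seq I) (P : pred I) (g : I -> V) :
  (forall i, P i -> Q (g i)) -> Q (\sum_(i <- r | P i) g i).
Proof.
by move=> Qg; apply: big_ind => //; [exact: lin_closed0 | exact: lin_closedD].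
Qed.

(* Evaluating a Lagrange polynomial of degree < m isolates each of the m
   values g i that are not yet known to lie in Q. *)
Lemma moments_mem (n : nat) (th : 'I_n -> F) (g : 'I_n -> V) (a m : nat) :
    injective th ->
    (forall i : 'I_n, ~~ (a <= i < a + m)%N -> Q (g i)) ->
    (forall t, (t < m)%N -> Q (\sum_i th i ^+ t *: g i)) ->
  forall i, Q (g i).
Proof.
move=> th_inj g_out g_mom i.
have [i_in|] := boolP (a <= i < a + m)%N; last exact: g_out.
pose S := [pred j : 'I_n | (a <= j < a + m)%N].
pose p := \prod_(j in [predD1 S & i]) ('X - (th j)%:P).
have size_p : (size p <= m)%N.
  rewrite /p -big_enum size_prod_XsubC -cardE.
  have S_le : (#|S| <= m)%N.
    rewrite cardE -(size_map val) -[X in (_ <= X)%N](size_iota a).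
    apply: uniq_leq_size => [|k /mapP[j]].
      by rewrite map_inj_uniq ?enum_uniq //; apply: val_inj.
    by rewrite mem_enum mem_iota => ? ->.
  by apply: leq_trans S_le; rewrite [X in (_ <= X)%N](cardD1 i) inE i_in.
have pi_neq0 : p.[th i] != 0.
  rewrite horner_prod; apply/prodf_neq0 => j /andP[j_neq_i _].
  by rewrite !hornerE subr_eq0; apply: contraNneq j_neq_i => /th_inj ->.
(* Expanding p in powers turns this sum into a combination of the given moments. Its terms other
   than the i-th are in Q: either p vanishes at [th j] or [g j] is known. *)
have Qp : Q (\sum_j p.[th j] *: g j).
  rewrite (eq_bigr (fun j => \sum_(t < m) p`_t *: (th j ^+ t *: g j))).
    rewrite exchange_big; apply: lin_closed_sum => t _ /=.
    by rewrite -scaler_sumr; apply/lin_closedZ/g_mom.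
  move=> j _; rewrite (horner_coef_wide _ size_p) scaler_suml.
  by apply: eq_bigr => t _; rewrite scalerA.
rewrite -[g i]scale1r -(mulVf pi_neq0) -scalerA; apply: lin_closedZ.
rewrite -[_ *: _](addrK (\sum_(j | j != i) p.[th j] *: g j)).
apply: lin_closedB; first by move: Qp; rewrite (bigD1 i).
apply: lin_closed_sum => j j_neq_i.
have [j_in|/g_out] := boolP (a <= j < a + m)%N; last exact: lin_closedZ.
rewrite horner_prod (bigD1 j) ?inE ?j_neq_i //=.
by rewrite !hornerE subrr mul0r scale0r; apply: lin_closed0.
Qed.

(* Rows and columns are cleared alternately: row m has b + 1 unknown entries,
   and once it is known, column m has b of them. *)
Lemma band_mem (n : nat) (th : 'I_n -> F) (b : nat) (g : 'I_n -> 'I_n -> V) :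
    injective th ->
    (forall i j : 'I_n, (b < (i - j) + (j - i))%N -> Q (g i j)) ->
    (forall i t, (t <= b)%N -> Q (\sum_j th j ^+ t *: g i j)) ->
    (forall j t, (t < b)%N -> Q (\sum_i th i ^+ t *: g i j)) ->
  forall i j, Q (g i j).
Proof.
move=> th_inj g_band g_row g_col.
have Qm m (i j : 'I_n) : (i < m)%N || (j < m)%N -> Q (g i j).
  elim: m i j => // m IHm.
  have Qrow (i j : 'I_n) : i = m :> nat -> Q (g i j).
    move=> im; apply: (@moments_mem _ th (g i) m b.+1) => [//|k|t].
      move=> k_out; have [k_lt|k_ge] := ltnP k m.
        by apply: IHm; rewrite k_lt orbT.
      by apply: g_band; lia.
    by rewrite ltnS; exact: g_row.
  have Qcol (i j : 'I_n) : j = m :> nat -> Q (g i j).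
    move=> jm; apply: (@moments_mem _ th (g^~ j) m.+1 b) => [//|k|t].
      move=> k_out; have [k_lt|k_ge] := ltnP k m.+1; last by apply: g_band; lia.
      move: k_lt; rewrite ltnS leq_eqVlt => /orP[/eqP/Qrow//|k_lt].
      by apply: IHm; rewrite k_lt.
    exact: g_col.
  move=> i j; rewrite !ltnS (leq_eqVlt i) (leq_eqVlt j).
  case/orP=> /orP[/eqP|lt]; [exact: Qrow | | exact: Qcol |].
    by apply: IHm; rewrite lt.
  by apply: IHm; rewrite lt orbT.
by move=> i j; apply: (Qm i.+1); rewrite ltnSn.
Qed.

End LinClosed.

Lemma lin_closed_eq0 (F : nzRingType) (V : lmodType F) :
  lin_closed (fun v : V => v = 0).
Proof. by split=> // a u v -> ->; rewrite scaler0 addr0. Qed.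

(* Downward induction on k: once f k' = 0 for all k' > k, the column condition
   confines f k to a band of half-width k - r, and then the strict upper
   triangle of f k has at most k - r entries in each row. *)
Lemma alternating_eq0 (F : fieldType) (V : lmodType F) (n r : nat)
    (th ths : 'I_n -> F) (f : 'I_n -> 'I_n -> 'I_n -> V) :
    injective th -> injective ths ->
    (forall k i, f k i i = 0) -> (forall k i j, f k i j = - f k j i) ->
    (forall (k i j : 'I_n), (k < r)%N -> f k i j = 0) ->
    (forall (k i : 'I_n) t, (t < k - r)%N -> \sum_j th j ^+ t *: f k i j = 0) ->
    (forall (i j : 'I_n) t, (t < (i - j) + (j - i))%N ->
      \sum_k ths k ^+ t *: f k i j = 0) ->
  forall k i j, f k i j = 0.
Proof.
move=> th_inj ths_inj f_diag f_alt f_low f_row f_col.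
have f0 m (k i j : 'I_n) : (n - m <= k)%N -> f k i j = 0.
  elim: m k i j => [|m IHm] k i j; first by have := ltn_ord k; lia.
  have [k_gt _|k_le k_ge] := leqP (n - m) k; first exact: IHm.
  have [/f_low//|r_le_k] := ltnP k r.
  (* Only the indices from r to k are still open, so the k - r + 1 moments of order at most k - r
     decide. *)
  have band (i' j' : 'I_n) : (k - r < (i' - j') + (j' - i'))%N -> f k i' j' = 0.
    move=> far.
    apply: (@moments_mem _ _ _ (@lin_closed_eq0 _ _) _ ths (fun k' => f k' i' j')
             r (k - r).+1) => // [k' k'_out | t t_le]; last by apply: f_col; lia.
    have [/f_low//|k'_ge] := ltnP k' r.
    by apply: IHm; lia.
  have low_rows s (i' j' : 'I_n) : (i' < s)%N -> f k i' j' = 0.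
    elim: s i' j' => // s IHs i' j'; rewrite ltnS leq_eqVlt.
    case/orP=> [/eqP i'_s|]; last exact: IHs.
    apply: (@moments_mem _ _ _ (@lin_closed_eq0 _ _) _ th (f k i') s.+1 (k - r))
      => // [j'' j''_out | t]; last exact: f_row.
    have [j''_lt|j''_ge] := ltnP j'' s; first by rewrite f_alt IHs ?oppr0.
    have [j''_s|j''_neq] := eqVneq (j'' : nat) s; last by apply: band; lia.
    by have -> : j'' = i' by apply: val_inj; rewrite /= i'_s.
  exact: (low_rows i.+1).
by move=> k i j; apply: (f0 n); rewrite subnn.
Qed.

(** * The corner of a block of a dual pair *)
Section DualPair.

(* [idm true] are the primitive idempotents E_i of A, [idm false] the dual ones
   E_i^*, and [pw true t], [pw false t] are the powers A^t and (A^* )^t. *)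
Variables (F : fieldType) (N n : nat).
Variables (idm : bool -> 'I_n -> 'M[F]_N) (th : bool -> 'I_n -> F).

Definition pw c t : 'M[F]_N := \sum_i th c i ^+ t *: idm c i.

(** Each of A and A^* acts tridiagonally on the eigenspaces of the other; the index c makes the
    condition symmetric in the two. With truncated subtraction, [(i - j) + (j - i)] is the distance
    |i - j|. *)
Record dual_pair : Prop := DualPair {
  dp_inj : forall c, injective (th c);
  dp_mul : forall c i j, idm c i *m idm c j = if i == j then idm c i else 0;
  dp_sum : forall c, \sum_i idm c i = 1%:M;
  dp_tr : forall c i, (idm c i)^T = idm c i;
  dp_band : forall c t (i j : 'I_n), (t < (i - j) + (j - i))%N ->
    idm c i *m pw (~~ c) t *m idm c j = 0 }.

(** In t steps that change the index by at most 1, no distance greater than t is covered. *)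
Lemma dual_pair_of_tridiagonal :
    (forall c, injective (th c)) ->
    (forall c i j, idm c i *m idm c j = if i == j then idm c i else 0) ->
    (forall c, \sum_i idm c i = 1%:M) ->
    (forall c i, (idm c i)^T = idm c i) ->
    (forall c (i j : 'I_n), (1 < (i - j) + (j - i))%N ->
      idm c i *m pw (~~ c) 1 *m idm c j = 0) ->
  dual_pair.
Proof.
move=> inj mul sum tr tri; split=> // c t.
elim: t => [|t IHt] i j t_lt.
  have -> : pw (~~ c) 0 = 1%:M.
    by rewrite -(sum (~~ c)); apply: eq_bigr => k _; rewrite expr0 scale1r.
  rewrite mulmx1 mul; case: eqP t_lt => // ->; lia.
have -> : pw (~~ c) t.+1 = pw (~~ c) t *m pw (~~ c) 1.
  rewrite /pw mulmx_suml; apply: eq_bigr => k _.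
  rewrite mulmx_sumr (bigD1 k) //= -scalemxAr -scalemxAl mul eqxx.
  rewrite big1 ?addr0 => [|l l_neq_k]; first by rewrite scalerA -exprS expr1.
  by rewrite -scalemxAr -scalemxAl mul eq_sym (negPf l_neq_k) !scaler0.
(* Inserting the sum of the idempotents splits off the last step: k is either more than 1 away from
   j or more than t away from i. *)
transitivity (\sum_k idm c i *m pw (~~ c) t *m idm c k *m pw (~~ c) 1 *m idm c j).
  by rewrite -!mulmx_suml -mulmx_sumr sum mulmx1 !mulmxA.
rewrite big1 // => k _.
have [k_far|k_near] := ltnP 1 ((k - j) + (j - k)).
  by rewrite -!mulmxA (mulmxA (idm c k)) tri ?mulmx0.
rewrite IHt ?mul0mx //; lia.
Qed.

Hypothesis dp : dual_pair.

(* z is a central idempotent of the algebra generated by the idempotents, and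
   r is the endpoint of the corresponding block. *)
Variables (z : 'M[F]_N) (r : 'I_n).
Hypothesis z_comm : forall c i, z *m idm c i = idm c i *m z.
Hypothesis z_idem : z *m z = z.
Hypothesis z_tr : z^T = z.
Hypothesis z_low : forall k : 'I_n, (k < r)%N -> idm false k *m z = 0.

Variable e : 'M[F]_N.
Hypothesis eE : e = idm false r *m z.

Definition corner_gen i : 'M[F]_N := e *m idm true i *m e.
Local Notation g := corner_gen.

Lemma corner_tr : e^T = e.
Proof. by rewrite eE trmx_mul z_tr (dp_tr dp) z_comm. Qed.

Lemma corner_mul_dual k : e *m idm false k = if k == r then e else 0.
Proof.
rewrite eE -mulmxA z_comm mulmxA (dp_mul dp) eq_sym.
by case: eqP => // _; rewrite mul0mx.
Qed.

Lemma dual_mul_corner k : idm false k *m e = if k == r then e else 0.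
Proof.
apply: trmx_inj; rewrite trmx_mul (dp_tr dp). rewrite corner_tr corner_mul_dual.
by case: eqP => _; rewrite ?trmx0 ?corner_tr.
Qed.

Lemma corner_idem : e *m e = e.
Proof. by rewrite {2}eE mulmxA corner_mul_dual eqxx eE -mulmxA z_idem. Qed.

Lemma mulz_corner : z *m e = e.
Proof. by rewrite eE mulmxA z_comm -mulmxA z_idem. Qed.

Lemma tr_pw c t : (pw c t)^T = pw c t.
Proof.
rewrite /pw raddf_sum /=; apply: eq_bigr => i _.
by rewrite linearZ /= (dp_tr dp).
Qed.

Lemma z_pw c t : z *m pw c t = pw c t *m z.
Proof.
rewrite /pw mulmx_sumr mulmx_suml; apply: eq_bigr => i _.
by rewrite -scalemxAr -scalemxAl z_comm.
Qed.

(** The block has no component below its endpoint r, and t tridiagonal steps from r do not pass r +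
    t. *)
Lemma corner_pw_dual t (k : 'I_n) :
  ~~ (r <= k < r + t.+1)%N -> e *m pw true t *m idm false k = 0.
Proof.
move=> k_out.
have -> : e *m pw true t *m idm false k =
          idm false r *m pw true t *m (idm false k *m z).
  by rewrite eE -!mulmxA -(z_comm _ k) !mulmxA -(mulmxA _ z) z_pw !mulmxA.
have [k_lt|k_ge] := ltnP k r; first by rewrite z_low ?mulmx0.
by rewrite mulmxA (dp_band dp) ?mul0mx //; lia.
Qed.

Lemma dual_pw_corner t (k : 'I_n) :
  ~~ (r <= k < r + t.+1)%N -> idm false k *m pw true t *m e = 0.
Proof.
move=> k_out; apply: trmx_inj.
rewrite trmx_mul (trmx_mul _ (pw _ _)) corner_tr tr_pw (dp_tr dp).
by rewrite mulmxA corner_pw_dual ?trmx0.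
Qed.

Lemma corner_comm i j : g i *m g j = g j *m g i.
Proof.
pose f k i j := e *m idm true i *m idm false k *m idm true j *m e
              - e *m idm true j *m idm false k *m idm true i *m e.
(* Since z is central and absorbed by the last e, the inner e can be replaced by [idm false r];
   hence the commutator of the generators is f at k = r. *)
have gg i' j' : g i' *m g j' = e *m idm true i' *m idm false r *m idm true j' *m e.
  have eEe : e *m idm true j' *m e = idm false r *m idm true j' *m e.
    by rewrite {1}eE -(mulmxA _ z) z_comm -!mulmxA mulz_corner.
  rewrite /corner_gen !mulmxA -(mulmxA _ e e) corner_idem.
  by rewrite -(mulmxA _ _ e) -(mulmxA _ e) (mulmxA e) eEe !mulmxA.
(* Summing over j' puts a power of A next to e in both terms, where the support bound applies. *)
have side1 (k i' : 'I_n) t : ~~ (r <= k < r + t.+1)%N ->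
    \sum_j' th true j' ^+ t *: f k i' j' = 0.
  move=> k_out.
  transitivity (e *m idm true i' *m idm false k *m pw true t *m e
              - e *m pw true t *m idm false k *m idm true i' *m e).
    rewrite /pw !(mulmx_sumr, mulmx_suml) -sumrB; apply: eq_bigr => j' _.
    by rewrite -!(scalemxAr, scalemxAl) scalerBr.
  rewrite corner_pw_dual // !mul0mx subr0 -!mulmxA [idm false k *m _]mulmxA.
  by rewrite dual_pw_corner // !mulmx0.
have pw0 : pw true 0 = 1%:M.
  by rewrite -(dp_sum dp true); apply: eq_bigr => i' _; rewrite expr0 scale1r.
apply/eqP; rewrite -subr_eq0 !gg; apply/eqP; rewrite -/(f r i j).
apply: (@alternating_eq0 _ _ _ r (th true) (th false))
  => [||k i'|k i' j'|k i' j' k_lt|k i' t t_lt|i' j' t t_lt].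
- exact: dp_inj.
- exact: dp_inj.
- by rewrite /f subrr.
- by rewrite /f opprB.
- have low i'' : e *m idm true i'' *m idm false k = 0.
    by rewrite eE -!mulmxA (mulmxA z) z_comm -mulmxA z_comm z_low ?mulmx0.
  by rewrite /f !low !mul0mx subrr.
- by apply: side1; lia.
- transitivity (e *m (idm true i' *m pw false t *m idm true j') *m e
              - e *m (idm true j' *m pw false t *m idm true i') *m e).
    rewrite /pw !(mulmx_sumr, mulmx_suml) -sumrB; apply: eq_bigr => k _.
    by rewrite -!(scalemxAr, scalemxAl) scalerBr !mulmxA.
  by rewrite !(@dp_band dp true) ?mulmx0 ?mul0mx ?subrr //; lia.
Qed.

(** Symmetry alone is not stable under products; commuting with the generators makes the product
    with a generator symmetric again. *)
Definition corner_good (M : 'M[F]_N) :=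
  M^T = M /\ forall i, g i *m M = M *m g i.

Lemma corner_good_lin : lin_closed corner_good.
Proof.
split=> [|a M M' [trM gM] [trM' gM']].
  by split=> [|i]; rewrite ?trmx0 // mulmx0 mul0mx.
split=> [|i]; first by rewrite linearP /= trM trM'.
by rewrite mulmxDr mulmxDl -scalemxAr -scalemxAl gM gM'.
Qed.

Lemma corner_good1 : corner_good e.
Proof.
split=> [|i]; first exact: corner_tr.
by rewrite /corner_gen -(mulmxA _ e) corner_idem !mulmxA corner_idem.
Qed.

Lemma corner_gen_tr i : (g i)^T = g i.
Proof. by rewrite /corner_gen !trmx_mul corner_tr (dp_tr dp) mulmxA. Qed.

Lemma corner_good_mul M i : corner_good M -> corner_good (M *m g i).
Proof.
case=> trM gM; split=> [|j]; first by rewrite trmx_mul trM corner_gen_tr.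
by rewrite mulmxA gM -(mulmxA M) corner_comm mulmxA.
Qed.

Lemma corner_good_mul_pw M t :
  corner_good M -> corner_good (M *m (e *m pw true t *m e)).
Proof.
move=> goodM; rewrite /pw !(mulmx_sumr, mulmx_suml).
apply: (lin_closed_sum corner_good_lin) => i _.
rewrite -!(scalemxAr, scalemxAl); apply: (lin_closedZ corner_good_lin).
exact: corner_good_mul.
Qed.

(** Words that start from e with a primitive idempotent and then alternate between dual and
    primitive ones; a dual letter next to e would be absorbed or give 0. [rword] is the mirror
    image, with e at the right end. *)
Fixpoint lword k (M : 'M[F]_N) : Prop :=
  if k is k'.+1 then exists l i, lword k' l /\ M = l *m idm (~~ odd k') i
  else M = e.

Fixpoint rword k (M : 'M[F]_N) : Prop :=
  if k is k'.+1 then exists l i, rword k' l /\ M = idm (~~ odd k') i *m l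
  else M = e.

(** Odd total length means that the letters that meet have different types, so the joined word still
    alternates. *)
Lemma lword_join k k' l l' : odd (k + k') -> lword k l -> rword k' l' ->
  exists2 l'', lword (k + k') l'' & l *m l' = l'' *m e.
Proof.
elim: k' k l l' => [|k' IHk] k l l'.
  by rewrite addn0 => _ lk /= ->; exists l.
rewrite addnS -addSn => odd_kk lk [l1 [i [l1k ->]]].
rewrite mulmxA; apply: IHk => //=; exists l, i; split=> //.
by move: odd_kk; rewrite addSn /= oddD; case: (odd k); case: (odd k').
Qed.

Lemma pw0 c : pw c 0 = 1%:M.
Proof.
by rewrite -(dp_sum dp c); apply: eq_bigr => i _; rewrite expr0 scale1r.
Qed.

Let goodZ := lin_closedZ corner_good_lin.
Let good_sum := lin_closed_sum corner_good_lin.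

Lemma mul_pwE c t (M M' : 'M[F]_N) :
  M *m pw c t *m M' = \sum_i th c i ^+ t *: (M *m idm c i *m M').
Proof.
rewrite /pw mulmx_sumr mulmx_suml; apply: eq_bigr => i _.
by rewrite -scalemxAr -scalemxAl.
Qed.

Lemma good_mul_pw c t (M M' : 'M[F]_N) :
    (forall i, corner_good (M *m idm c i *m M')) ->
  corner_good (M *m pw c t *m M').
Proof. by move=> goodM; rewrite mul_pwE; apply: good_sum => i _; apply: goodZ. Qed.

Lemma good_mul_idm c (M M' : 'M[F]_N) a m :
    (forall i : 'I_n, ~~ (a <= i < a + m)%N -> corner_good (M *m idm c i *m M')) ->
    (forall t, (t < m)%N -> corner_good (M *m pw c t *m M')) ->
  forall i, corner_good (M *m idm c i *m M').
Proof.
move=> good_out good_mom.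
apply: (moments_mem corner_good_lin (g := fun i => M *m idm c i *m M')
  (dp_inj dp (c := c)) good_out) => t /good_mom.
by rewrite mul_pwE.
Qed.

Lemma good0 M : M = 0 -> corner_good M.
Proof. by move->; apply: lin_closed0 corner_good_lin. Qed.

Lemma dual_pw_corner_endpoint t :
  idm false r *m (pw true t *m e) = e *m pw true t *m e.
Proof.
by rewrite {2}eE -(mulmxA _ z) z_pw -!mulmxA mulz_corner.
Qed.

(* A word of length k + 1 + k' = odd whose factor in an interior position is
   the power b of A or A^*. The exponent b decreases, or else the position of
   the factor moves to the right; at either end the bound on the support of
   e *m A^t in terms of the dual idempotents is used instead of band_mem. *)
Lemma corner_words_good w :
  odd w -> forall l, lword w l -> corner_good (l *m e).
Proof.
have [m] := ubnP w; elim: m w => // m IHm w /ltnSE w_le w_odd.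
(* Three nested inductions: on the length of the word, on the exponent b, and for fixed b on the
   length of the right part. *)
have inner b k' k l l' : (0 < k)%N -> (0 < k')%N -> (k + k').+1 = w ->
    lword k l -> rword k' l' -> corner_good (l *m pw (~~ odd k) b *m l').
  elim/ltn_ind: b k' k l l' => b IHb k'.
  elim: k' => // k' IHk' [//|k] l l' _ _ kk'_w.
  have par : odd k' = odd k.
    by move: w_odd; rewrite -kk'_w !(addnS, addSn) /= oddD negbK;
       case: (odd k); case: (odd k').
  (* For exponent 0 the two neighbouring letters have the same type: they merge, shortening the word
     by two, or their product is 0. *)
  have [b0|b_gt0] := posnP b.
    rewrite b0 pw0 mulmx1 /= => -[l1 [i [l1k ->]]] [l1' [i' [l1k' ->]]].
    rewrite par mulmxA -(mulmxA l1) (dp_mul dp).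
    case: eqP => _; last by apply: good0; rewrite mulmx0 mul0mx.
    have [|||l2 l2k ->] := @lword_join k.+1 k' (l1 *m idm (~~ odd k) i) l1'.
    - by rewrite addSn /= oddD par addbb.
    - by exists l1, i.
    - by [].
    by apply: IHm l2k; [lia | rewrite addSn /= oddD par addbb].
  move=> [l1 [i [l1k ->]]] [l1' [i' [l1k' ->]]].
  rewrite par /= negbK.
  (* Both letters next to the power are freed; G is a band matrix in their indices, of half-width
     b. *)
  pose G i j := l1 *m (idm (~~ odd k) i *m pw (odd k) b *m idm (~~ odd k) j) *m l1'.
  have -> : l1 *m idm (~~ odd k) i *m pw (odd k) b *m (idm (~~ odd k) i' *m l1') = G i i'.
    by rewrite /G !mulmxA.
  apply: (band_mem corner_good_lin (th := th (~~ odd k)) (b := b)); first exact: dp_inj.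
  - move=> i1 j1 far; have := @dp_band dp (~~ odd k) b i1 j1 far; rewrite negbK /G => ->.
    by apply: good0; rewrite mulmx0 mul0mx.
  - move=> i1 t t_le.
    have -> : \sum_j th (~~ odd k) j ^+ t *: G i1 j =
      (l1 *m idm (~~ odd k) i1 *m pw (odd k) b) *m pw (~~ odd k) t *m l1'.
      by rewrite mul_pwE; apply: eq_bigr => j _; rewrite /G !mulmxA.
    (* At the right end A^t e is supported on the dual indices r, ..., r + t. Index r splits off an
       element of the corner and leaves a shorter word; the other t indices are eliminated by
       moments s < t <= b. *)
    clear G; case: k' => [|k'] in IHk' kk'_w par l1k' *.
      have k_even : odd k = false by rewrite -par.
      rewrite k_even /= in l1k' *; rewrite {l1'}l1k'.
      rewrite -(mulmxA _ (pw true t)).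
      apply: good_mul_pw; apply: (@good_mul_idm _ _ _ r.+1 t) => [i2 i2_out|s s_lt].
        have [->|i2_neq] := eqVneq i2 r; last first.
          apply: good0; rewrite -mulmxA (mulmxA (idm _ i2)) dual_pw_corner ?mulmx0 //.
          by move: i2_neq; rewrite -val_eqE /=; lia.
        rewrite -mulmxA dual_pw_corner_endpoint -{1}corner_idem -!(mulmxA e) mulmxA.
        rewrite (mulmxA e (pw _ _)).
        apply: corner_good_mul_pw; apply: (IHm k.+1); first by lia.
          by rewrite /= k_even.
        by exists l1, i1; rewrite k_even.
      have -> : l1 *m idm true i1 *m pw false s *m (pw true t *m e) =
        (l1 *m idm true i1 *m pw false s) *m pw true t *m e by rewrite !mulmxA.
      apply: good_mul_pw => j.
      have -> : l1 *m idm true i1 *m pw false s *m idm true j *m e =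
        l1 *m idm true i1 *m pw (~~ odd k.+1) s *m (idm true j *m e).
        by rewrite /= k_even !mulmxA.
      apply: (IHb s _ 1) => //; first by lia.
        by exists l1, i1; rewrite k_even.
      by exists e, j.
    (* Away from the end, the power b is expanded into a letter of the left part, so that the power
       t stands one place further right; t = b falls under [IHk'], t < b under [IHb]. *)
    have -> : l1 *m idm (~~ odd k) i1 *m pw (odd k) b *m pw (~~ odd k) t *m l1' =
      (l1 *m idm (~~ odd k) i1) *m pw (odd k) b *m (pw (~~ odd k) t *m l1').
      by rewrite !mulmxA.
    apply: good_mul_pw => i2.
    have -> : l1 *m idm (~~ odd k) i1 *m idm (odd k) i2 *m (pw (~~ odd k) t *m l1') =
      (l1 *m idm (~~ odd k) i1 *m idm (odd k) i2) *m pw (~~ odd k.+2) t *m l1'.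
      by rewrite /= negbK !mulmxA.
    have Lk2 : lword k.+2 (l1 *m idm (~~ odd k) i1 *m idm (odd k) i2).
      exists (l1 *m idm (~~ odd k) i1), i2; split; last by rewrite /= negbK.
      by exists l1, i1.
    move: t_le; rewrite leq_eqVlt => /orP[/eqP->|t_lt].
      by apply: IHk' => //; lia.
    by apply: (IHb t t_lt k'.+1) => //; lia.
  - move=> j1 t t_lt.
    have -> : \sum_i th (~~ odd k) i ^+ t *: G i j1 =
      l1 *m pw (~~ odd k) t *m (pw (odd k) b *m idm (~~ odd k) j1 *m l1').
      by rewrite mul_pwE; apply: eq_bigr => j _; rewrite /G !mulmxA.
    have -> : l1 *m pw (~~ odd k) t *m (pw (odd k) b *m idm (~~ odd k) j1 *m l1') =
      (l1 *m pw (~~ odd k) t) *m pw (odd k) b *m (idm (~~ odd k) j1 *m l1').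
      by rewrite !mulmxA.
    apply: good_mul_pw => i2.
    (* Here t < b, so the position of the power is free. At the left end e A^t is supported on t + 1
       dual indices from r on, which moments s <= t < b eliminate. *)
    clear G; case: k => [|k] in i i2 IHk' kk'_w par l1k l1k' *.
      rewrite /= in l1k par l1k' *; rewrite {l1}l1k.
      move: i2; apply: (@good_mul_idm _ _ _ r t.+1) => [i2 i2_out|s s_lt].
        by apply: good0; rewrite corner_pw_dual ?mul0mx.
      have -> : e *m pw true t *m pw false s *m (idm true j1 *m l1') =
        e *m pw true t *m (pw false s *m (idm true j1 *m l1')) by rewrite !mulmxA.
      apply: good_mul_pw => i1; rewrite mulmxA.
      apply: (IHb s _ k'.+1 1) => //; [lia | by exists e, i1 |].
      by exists l1', j1; rewrite par.
    have -> : l1 *m pw (~~ odd k.+1) t *m idm (odd k.+1) i2 *m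
        (idm (~~ odd k.+1) j1 *m l1') =
      l1 *m pw (~~ odd k.+1) t *m (idm (odd k.+1) i2 *m
        (idm (~~ odd k.+1) j1 *m l1')) by rewrite !mulmxA.
    apply: (IHb t t_lt k'.+2) => //; first by lia.
    exists (idm (~~ odd k.+1) j1 *m l1'), i2; split; last by rewrite /= par negbK.
    by exists l1', j1; rewrite par.
case: w => [//|[|w]] in inner w_odd w_le *.
  move=> _ [_ [i [-> ->]]].
  have -> : e *m idm true i *m e = e *m g i.
    by rewrite /corner_gen !mulmxA corner_idem.
  exact: corner_good_mul corner_good1.
have w_odd' : odd w by move: w_odd; rewrite /= negbK.
(* The last dual letter is freed completely: all n of its values follow from n moments, which
   [inner] supplies with k' = 1. *)
move=> _ [_ [i [[l [i2 [lw ->]] ->]]]].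
rewrite /= w_odd' /= -mulmxA; move: i2.
apply: (@good_mul_idm _ _ _ 0 n) => [i2|t _]; first by rewrite ltn_ord.
have := inner t 1 w l (idm true i *m e); rewrite w_odd' /=; apply => //.
- by case: (w) w_odd'.
- by lia.
- by exists e, i.
Qed.

(** The linear span of the words, as the intersection of all subspaces that contain them. *)
Definition lword_span (u : 'M[F]_N) :=
  forall Q : 'M[F]_N -> Prop, lin_closed Q ->
    (forall k l, lword k l -> Q l) -> Q u.

Lemma lword_span_lin : lin_closed lword_span.
Proof.
split=> [|a u v Su Sv] Q Q_lin Qw; first exact: lin_closed0.
by case: (Q_lin) => _; apply; [apply: Su | apply: Sv].
Qed.

(** A letter of the same type as the last one merges with it or gives 0; a different letter
    lengthens the word, except that e absorbs or annihilates a dual letter. *)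
Lemma lword_span_mul_idm u c i : lword_span u -> lword_span (u *m idm c i).
Proof.
move=> Su Q Q_lin Qw; apply: (Su (fun v => Q (v *m idm c i))).
  split=> [|a v v' Qv Qv']; first by rewrite mul0mx; apply: lin_closed0.
  by rewrite mulmxDl -scalemxAl; case: (Q_lin) => _; apply.
move=> k l lk; have [->|c_neq] := eqVneq c (~~ odd k).
  by apply: (Qw k.+1); exists l, i.
have -> : c = odd k by case: (c) (odd k) c_neq => [] [].
case: k => [|k] in lk {c_neq} *.
  rewrite lk corner_mul_dual; case: eqP => _; last exact: lin_closed0.
  exact: (Qw 0).
case: (lk) => l1 [j [l1k l_eq]]; rewrite /= l_eq -mulmxA (dp_mul dp).
case: eqP => _; last by rewrite mulmx0; apply: lin_closed0.
by apply: (Qw k.+1); rewrite -l_eq.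
Qed.

Lemma corner_gen_subalg_tr A M : pw true 1 = A ->
    gen_subalg (fun M' => M' = A \/ exists i, M' = idm false i) M ->
  (e *m M *m e)^T = e *m M *m e.
Proof.
move=> <- genM; have SM : forall u, lword_span u -> lword_span (u *m M).
  elim: genM => {M} [M|u|M M' _ SM _ SM' u Su|a M _ SM u Su|M M' _ SM _ SM' u Su].
  - case=> [->|[i ->]] u Su; last exact: lword_span_mul_idm.
    rewrite /pw mulmx_sumr; apply: (lin_closed_sum lword_span_lin) => i _.
    rewrite -scalemxAr; apply: (lin_closedZ lword_span_lin).
    exact: lword_span_mul_idm.
  - by rewrite mulmx1.
  - by rewrite mulmxDr; apply: (lin_closedD lword_span_lin); [apply: SM | apply: SM'].
  - by rewrite -scalemxAr; apply: (lin_closedZ lword_span_lin); apply: SM.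
  - by rewrite mulmxA; apply: SM'; apply: SM.
suff [] : corner_good (e *m M *m e) by [].
apply: (SM e _ (fun u => corner_good (u *m e))) => [Q _ Qw||k l lk].
- exact: (Qw 0).
- split=> [|a u v gu gv]; first by apply: good0; rewrite mul0mx.
  by rewrite mulmxDl -scalemxAl; case: corner_good_lin => _; apply.
(* A word of positive even length ends in a dual letter, which the closing e absorbs or annihilates;
   a word of odd length remains. *)
have [k_odd|k_even] := boolP (odd k); first exact: corner_words_good lk.
case: k => [|k] in lk k_even *.
  by rewrite lk corner_idem; apply: corner_good1.
case: lk => l1 [i [l1k ->]].
rewrite /= negbK in k_even; rewrite k_even -mulmxA dual_mul_corner.
case: eqP => _; last by apply: good0; rewrite mulmx0.
exact: corner_words_good l1k.
Qed.

End DualPair.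

(** * Distance-regular graphs *)
Section Distance.
Variables (X : finType) (e : rel X).
Hypothesis e_graph : connected_simple_graph e.
Implicit Types y z w : X.

Local Notation D := (diameter e).

Lemma walkP n y z :
  reflect (exists p, [/\ path e y p, last y p = z & size p = n]) (walk e n y z).
Proof.
apply: (iffP existsP) => [[p /andP[yp /eqP zp]]|[p [yp zp /eqP size_p]]].
  by exists p; rewrite size_tuple.
by exists (Tuple size_p); rewrite /= yp zp eqxx.
Qed.

Lemma dist_le_walk n y z : walk e n y z -> (dist e y z <= n)%N.
Proof.
move=> yz; have [n_lt|n_ge] := ltnP n #|X|; last first.
  apply: leq_trans n_ge; rewrite /dist.
  by rewrite -[X in (_ <= X)%N](size_iota 0 #|X|) find_size.
rewrite leqNgt; apply/negP => /(before_find 0).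
by rewrite nth_iota // add0n yz.
Qed.

(** Connectedness gives a path without repeated vertices; its length is below [#|X|], so the junk
    value of [dist] does not occur. *)
Lemma walk_dist y z : walk e (dist e y z) y z.
Proof.
have has_walk : has (fun n => walk e n y z) (iota 0 #|X|).
  have [_ _ /(_ y z) /connectP[p yp ->]] := e_graph.
  case/shortenP: yp => p' yp' p'_uniq _; apply/hasP; exists (size p').
    rewrite mem_iota add0n /= -[(size p').+1]/(size (y :: p')).
    by rewrite -(card_uniqP p'_uniq) max_card.
  by apply/walkP; exists p'.
have := nth_find 0 has_walk; rewrite nth_iota // -[X in (_ < X)%N](size_iota 0).
by rewrite -has_find.
Qed.

Lemma dist_eq0 y z : (dist e y z == 0) = (y == z).
Proof.
apply/eqP/eqP => [d0|->].
  by have := walk_dist y z; rewrite d0 => /walkP[[|w p] []].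
by apply/eqP; rewrite -leqn0; apply: dist_le_walk; apply/walkP; exists [::].
Qed.

Lemma dist_triangle y z w : (dist e y z <= dist e y w + dist e w z)%N.
Proof.
have /walkP[p [yp w_eq size_p]] := walk_dist y w.
have /walkP[q [wq z_eq size_q]] := walk_dist w z.
apply/dist_le_walk/walkP; exists (p ++ q).
by rewrite cat_path yp w_eq wq last_cat w_eq z_eq size_cat size_p size_q.
Qed.

Lemma dist_eq1 y z : (dist e y z == 1)%N = e y z.
Proof.
have [_ e_irr _] := e_graph.
apply/eqP/idP => [d1|yz].
  have := walk_dist y z; rewrite d1 => /walkP[[|w [|w' p]] [] //=].
  by rewrite andbT => yw <-.
have y_neq_z : y != z by apply: contraTneq yz => ->; rewrite e_irr.
apply/eqP; rewrite eqn_leq lt0n dist_eq0 y_neq_z andbT.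
by apply/dist_le_walk/walkP; exists [:: z]; rewrite /= yz.
Qed.

Lemma dist_sym y z : dist e y z = dist e z y.
Proof.
have [e_sym _ _] := e_graph.
suff le y' z' : (dist e y' z' <= dist e z' y')%N by apply/eqP; rewrite eqn_leq !le.
have /walkP[p [zp y_eq size_p]] := walk_dist z' y'.
apply/dist_le_walk/walkP; exists (rev (belast z' p)).
rewrite size_rev size_belast size_p; split=> //; last first.
  by case: (p) y_eq => //= w q _; rewrite rev_cons last_rcons.
by rewrite -y_eq rev_path (eq_path (e' := e)) // => u v; rewrite /= e_sym.
Qed.

Lemma dist_leD y z : (dist e y z <= D)%N.
Proof. exact: (leq_bigmax (y, z)). Qed.

(** A shortest walk without its last edge is again a shortest walk. *)
Lemma dist_step y z d : dist e y z = d.+1 -> exists2 w, dist e y w = d & e w z.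
Proof.
move=> dyz; have := walk_dist y z; rewrite dyz => /walkP[p [yp z_eq size_p]].
case/lastP: p => [//|p w] in yp z_eq size_p *.
rewrite rcons_path last_rcons size_rcons in yp z_eq size_p.
case/andP: yp => yp; rewrite z_eq => pz; exists (last y p) => //.
case: size_p => size_p; apply/eqP; rewrite eqn_leq.
rewrite dist_le_walk /=; last by apply/walkP; exists p.
have := dist_triangle y z (last y p); rewrite dyz.
by move: pz; rewrite -dist_eq1 => /eqP ->; rewrite addn1 ltnS.
Qed.

(** Stepping back along a shortest walk between two vertices at distance D realises every smaller
    distance. *)
Lemma dist_onto d : X -> (d <= D)%N -> exists y z, dist e y z = d.
Proof.
move=> x; have [[y z] Dyz] : {yz : X * X | D = dist e yz.1 yz.2}.
  apply: (bigop.eq_bigmax (fun yz => dist e yz.1 yz.2)).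
  by apply/card_gt0P; exists (x, x).
rewrite /= in Dyz; move: d; suff onto m : (m <= D)%N -> exists z', dist e y z' = (D - m)%N.
  move=> d d_le; have [|z' dz'] := onto (D - d)%N; first exact: leq_subr.
  by exists y, z'; rewrite dz' subKn.
elim: m => [_|m IHm m_lt]; first by exists z; rewrite subn0.
have [z' dz'] := IHm (ltnW m_lt).
have [|w dw _] := @dist_step y z' (D - m.+1); last by exists w.
by rewrite dz' -subSn.
Qed.

End Distance.

(** * Polynomials of a matrix *)
Section PolynomialOfMatrix.
Variables (F : fieldType) (N : nat) (A : 'M[F]_N).
Implicit Types p q : {poly F}.

Definition poly_mx (p : {poly F}) : 'M[F]_N := \sum_(i < size p) p`_i *: A ^+ i.

Lemma poly_mx_wide n p :
  (size p <= n)%N -> poly_mx p = \sum_(i < n) p`_i *: A ^+ i.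
Proof.
move=> p_le; rewrite /poly_mx (big_ord_widen n (fun i => p`_i *: A ^+ i)) //.
rewrite big_mkcond; apply: eq_bigr => i _; case: ltnP => // i_ge.
by rewrite nth_default ?scale0r.
Qed.

Lemma poly_mxP a p q : poly_mx (a *: p + q) = a *: poly_mx p + poly_mx q.
Proof.
have p_le : (size p <= maxn (size p) (size q))%N by apply: leq_maxl.
have q_le : (size q <= maxn (size p) (size q))%N by apply: leq_maxr.
rewrite (poly_mx_wide p_le) (poly_mx_wide q_le).
rewrite (@poly_mx_wide (maxn (size p) (size q))); last first.
  rewrite (leq_trans (size_polyD _ _)) // geq_max q_le andbT.
  exact: leq_trans (size_scale_leq _ _) p_le.
rewrite scaler_sumr -big_split; apply: eq_bigr => i _ /=.
by rewrite coefD coefZ scalerDl scalerA.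
Qed.

Lemma poly_mx0 : poly_mx 0 = 0.
Proof. by rewrite /poly_mx size_poly0 big_ord0. Qed.

Lemma poly_mx1 : poly_mx 1 = 1%:M.
Proof. by rewrite /poly_mx size_poly1 big_ord1 coef1 scale1r expr0. Qed.

Lemma poly_mxZ a p : poly_mx (a *: p) = a *: poly_mx p.
Proof. by rewrite -[_ *: p]addr0 poly_mxP poly_mx0 addr0. Qed.

Lemma poly_mx_sum (I : Type) (r : seq I) (g : I -> {poly F}) :
  poly_mx (\sum_(i <- r) g i) = \sum_(i <- r) poly_mx (g i).
Proof.
apply: (big_morph poly_mx) => [p q|]; last exact: poly_mx0.
by rewrite -[p]scale1r poly_mxP !scale1r.
Qed.

Lemma poly_mxXsubC a p : poly_mx (('X - a%:P) * p) = (A - a%:M) *m poly_mx p.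
Proof.
rewrite mulrBl mulmxBl mul_scalar_mx mul_polyC addrC -scaleNr poly_mxP scaleNr.
rewrite addrC; congr (_ - _).
rewrite (@poly_mx_wide (size p).+1); last first.
  have [->|p_neq0] := eqVneq p 0; first by rewrite mulr0 size_poly0.
  by rewrite mulrC size_mulX.
rewrite big_ord_recl coefXM eqxx scale0r add0r /poly_mx mulmx_sumr.
by apply: eq_bigr => i _; rewrite coefXM /= exprS scalemxAr.
Qed.

Lemma poly_mx_mulr (M : 'M[F]_N) a p :
  A *m M = a *: M -> poly_mx p *m M = p.[a] *: M.
Proof.
move=> AM; have AkM k : A ^+ k *m M = a ^+ k *: M.
  elim: k => [|k IHk]; first by rewrite !expr0 mul1mx scale1r.
  by rewrite exprSr -mulmxA AM -scalemxAr IHk scalerA exprS.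
rewrite horner_coef scaler_suml mulmx_suml; apply: eq_bigr => i _.
by rewrite -scalemxAl AkM scalerA.
Qed.

Lemma poly_mx_mull (M : 'rV[F]_N) a p :
  M *m A = a *: M -> M *m poly_mx p = p.[a] *: M.
Proof.
move=> MA; have MAk k : M *m A ^+ k = a ^+ k *: M.
  elim: k => [|k IHk]; first by rewrite !expr0 mulmx1 scale1r.
  by rewrite exprSr mulmxA IHk -scalemxAl MA scalerA exprSr.
rewrite horner_coef scaler_suml mulmx_sumr; apply: eq_bigr => i _.
by rewrite -scalemxAr MAk scalerA.
Qed.

End PolynomialOfMatrix.

(** * Spectral idempotents by Lagrange interpolation *)

Section LagrangeIdempotents.
Variables (F : fieldType) (N n : nat) (A : 'M[F]_N) (th : 'I_n.+1 -> F).
Hypothesis th_inj : injective th.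
Hypothesis A_annul : poly_mx A (\prod_i ('X - (th i)%:P)) = 0.

Definition lagrange_poly i : {poly F} :=
  (\prod_(j | j != i) (th i - th j))^-1 *: \prod_(j | j != i) ('X - (th j)%:P).

Lemma lagrange_polyE i j : (lagrange_poly i).[th j] = (i == j)%:R.
Proof.
rewrite /lagrange_poly hornerZ horner_prod.
have [<-|i_neq_j] := eqVneq i j; last first.
  by rewrite [X in _ * X](bigD1 j) 1?eq_sym //= hornerXsubC subrr /= mul0r mulr0.
under [X in _ * X]eq_bigr do rewrite hornerXsubC.
rewrite mulVf //; apply/prodf_neq0 => k k_neq_i.
by rewrite subr_eq0; apply: contraNneq k_neq_i => /th_inj ->.
Qed.

Definition lagrange_idem i := poly_mx A (lagrange_poly i).

(** Multiplying the i-th Lagrange polynomial by X - th i gives a multiple of the annihilating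
    polynomial. *)
Lemma mul_lagrange_idem i : A *m lagrange_idem i = th i *: lagrange_idem i.
Proof.
apply/eqP; rewrite -subr_eq0 -mul_scalar_mx -mulmxBl -poly_mxXsubC.
rewrite /lagrange_poly -scalerAr poly_mxZ.
have := bigD1 i (F := fun j => 'X - (th j)%:P) (P := predT) isT => /= <-.
by rewrite A_annul scaler0.
Qed.

Lemma lagrange_idem_mul i j :
  lagrange_idem i *m lagrange_idem j = if i == j then lagrange_idem i else 0.
Proof.
rewrite (poly_mx_mulr _ (mul_lagrange_idem j)) lagrange_polyE.
by case: eqP => [->|_]; rewrite ?scale1r ?scale0r.
Qed.

(** The Lagrange polynomials sum to 1: the difference has degree at most n and the n + 1 roots
    [th j]. *)
Lemma lagrange_idem_sum : \sum_i lagrange_idem i = 1%:M.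
Proof.
rewrite -poly_mx_sum -(poly_mx1 A); congr poly_mx.
apply/eqP; rewrite -subr_eq0; set p := _ - 1.
have p_root : all (root p) [seq th i | i <- enum 'I_n.+1].
  apply/allP => _ /mapP[j _ ->]; rewrite /root /p !hornerE horner_sum.
  rewrite (bigD1 j) //= lagrange_polyE eqxx big1 ?addr0 ?subrr // => i i_neq_j.
  by rewrite lagrange_polyE (negPf i_neq_j).
apply/eqP; apply: (roots_geq_poly_eq0 p_root).
  by rewrite map_inj_uniq ?enum_uniq.
rewrite size_map size_enum_ord /p (leq_trans (size_polyD _ _)) // geq_max.
rewrite size_polyN size_poly1 andbT.
apply: (big_ind (fun q : {poly F} => (size q <= n.+1)%N))
  => [|q q' q_le q'_le|i _]; first by rewrite size_poly0.
  by rewrite (leq_trans (size_polyD _ _)) // geq_max q_le.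
rewrite (leq_trans (size_scale_leq _ _)) //.
have -> : \prod_(j | j != i) ('X - (th j)%:P) =
    \prod_(j <- enum (predC1 i)) ('X - (th j)%:P) by rewrite big_enum.
rewrite size_prod_XsubC -cardE.
by have := cardC1 i; rewrite card_ord => ->.
Qed.

Lemma lagrange_idem_tr i : A^T = A -> (lagrange_idem i)^T = lagrange_idem i.
Proof.
move=> trA; rewrite /lagrange_idem /poly_mx raddf_sum /=; apply: eq_bigr => k _.
rewrite linearZ /=; congr (_ *: _).
elim: (k : nat) => [|k' IHk]; first by rewrite expr0 trmx1.
by rewrite [RHS]exprS exprSr trmx_mul IHk trA.
Qed.

End LagrangeIdempotents.

(** * Positivity of the trace form and orthogonal projections *)

Lemma mulmx_tr_eq0 (R : realDomainType) m n (M : 'M[R]_(m, n)) :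
  \tr (M *m M^T) = 0 -> M = 0.
Proof.
move=> tr0; apply/matrixP => i j; rewrite mxE.
have sq_ge0 (k : 'I_m) : 0 <= (M *m M^T) k k.
  by rewrite mxE; apply: sumr_ge0 => l _; rewrite mxE -expr2 sqr_ge0.
have : (M *m M^T) i i = 0.
  exact: (psumr_eq0P (P := predT) (F := fun k => (M *m M^T) k k) _ tr0).
rewrite mxE => Mi0; have /eqP : M i j * M^T j i = 0.
  apply: (psumr_eq0P (P := predT) (F := fun l => M i l * M^T l i) _ Mi0) => // l _.
  by rewrite mxE -expr2 sqr_ge0.
by rewrite mxE mulf_eq0 orbb => /eqP.
Qed.

(* The squared norm of P diag(a) Q is tr (P diag(a) Q diag(a)). *)
Lemma mul_diag_proj_eq0 (R : realDomainType) n (P Q : 'M[R]_n) (a : 'rV_n) :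
    P^T = P -> Q^T = Q -> P *m P = P -> Q *m Q = Q ->
    a *m map2_mx *%R P Q *m a^T = 0 ->
  P *m diag_mx a *m Q = 0.
Proof.
move=> trP trQ PP QQ aPQ; apply: mulmx_tr_eq0.
rewrite !trmx_mul tr_diag_mx trP trQ !mulmxA -(mulmxA _ Q Q) QQ.
rewrite mxtrace_mulC !mulmxA PP.
transitivity ((a *m map2_mx *%R P Q *m a^T) 0 0); last by rewrite aPQ mxE.
rewrite [RHS]mxE /mxtrace; apply: eq_bigr => v _.
rewrite -[P *m _ *m Q *m _]mulmxA mxE mxE mulr_suml; apply: eq_bigr => u _.
rewrite -{1}trP !mul_mx_diag !mxE; ring.
Qed.

(** By positivity the row space of U meets its orthogonal complement only in 0; in 1 = (1 - P) + P
    the first summand maps into the complement, the second into the row space. *)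
Lemma orth_proj_eq (R : realFieldType) (m n : nat) (U : 'M[R]_(m, n)) (P : 'M_n) :
  P^T = P -> (P <= U)%MS -> U *m P = U -> orth_proj U = P.
Proof.
move=> trP P_le UP; rewrite /orth_proj; set K := kermx _.
have UK0 : (<<U>> :&: K)%MS = 0.
  apply/eqP/rowV0P => v; rewrite sub_capmx genmxE => /andP[/submxP[w ->]].
  move=> /sub_kermxP wUU0; apply: mulmx_tr_eq0.
  by rewrite trmx_mul mulmxA wUU0 mul0mx mxtrace0.
rewrite -[LHS]mul1mx -[1%:M](subrK P) mulmxDl (proj_mx_0 UK0) ?add0r.
  by rewrite (proj_mx_id UK0) // genmxE.
by apply/sub_kermxP; rewrite mulmxBl mul1mx -{1}trP -trmx_mul UP subrr.
Qed.

(** * Spectral theory of distance-regular graphs *)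

Section DistanceRegular.
Variables (R : realFieldType) (X : finType) (e : rel X).
Hypothesis e_drg : distance_regular e.
Hypothesis D_gt0 : (0 < diameter e)%N.

Local Notation N := #|X|.
Local Notation D := (diameter e).
Local Notation A := (adjmx e R).

Let e_graph : connected_simple_graph e. Proof. by case: e_drg. Qed.

Definition vdist (u v : 'I_N) := dist e (enum_val u) (enum_val v).

Lemma vdist_lt u v : (vdist u v < D.+1)%N.
Proof. exact: dist_leD. Qed.

(** Membership in the Bose-Mesner algebra, the span of the distance matrices. *)
Definition dist_const (M : 'M[R]_N) :=
  forall u v u' v', vdist u v = vdist u' v' -> M u v = M u' v'.

Lemma dist_const_lin : lin_closed dist_const.
Proof.
split=> [u v u' v' _|a M M' cM cM' u v u' v' duv]; rewrite !mxE //.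
by rewrite (cM _ _ _ _ duv) (cM' _ _ _ _ duv).
Qed.

Definition dist_value (M : 'M[R]_N) (j : nat) : R :=
  if [pick uv : 'I_N * 'I_N | vdist uv.1 uv.2 == j] is Some uv
  then M uv.1 uv.2 else 0.

Lemma dist_valueE M u v : dist_const M -> M u v = dist_value M (vdist u v).
Proof.
rewrite /dist_value => cM; case: pickP => [[u' v'] /eqP/= duv|].
  by apply: cM; rewrite duv.
by move=> /(_ (u, v)); rewrite eqxx.
Qed.

Lemma dist_const1 : dist_const 1%:M.
Proof.
move=> u v u' v' duv; rewrite !mxE; congr (_%:R); congr nat_of_bool.
have eqE (w w' : 'I_N) : (w == w') = (vdist w w' == 0).
  by rewrite /vdist dist_eq0 // (inj_eq enum_val_inj).
by rewrite !eqE duv.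
Qed.

(** Sorting the neighbours of v by their distance j from u makes the (u, v)-entry a sum of values of
    M weighted by the intersection numbers p^h_{j,1}, where h is the distance of u and v. *)
Lemma dist_const_mul_adjmx M : dist_const M -> dist_const (M *m A).
Proof.
move=> cM u v u' v' duv; pose c := dist_value M.
have MA w w' : (M *m A) w w' =
    \sum_(j < D.+1) c j * (pcount e j 1 (enum_val w) (enum_val w'))%:R.
  rewrite mxE.
  transitivity (\sum_(y : X) c (dist e (enum_val w) y) *
                  (dist e (enum_val w') y == 1%N)%:R).
    rewrite [RHS](reindex (fun k : 'I_N => enum_val k)) /=; last first.
      exact/onW_bij/enum_val_bij.
    apply: eq_bigr => k _; rewrite (dist_valueE _ _ cM) mxE.
    by rewrite -dist_eq1 // dist_sym.
  transitivity (\sum_(j < D.+1) \sum_(y : X) c j *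
     ((dist e (enum_val w) y == j) && (dist e (enum_val w') y == 1%N))%:R).
    rewrite exchange_big; apply: eq_bigr => y _ /=.
    rewrite (bigD1 (Ordinal (dist_leD e (enum_val w) y : (_ < D.+1)%N))) //=.
    rewrite eqxx /= big1 ?addr0 // => j j_neq.
    by rewrite -val_eqE /= eq_sym in j_neq; rewrite (negPf j_neq) mulr0.
  apply: eq_bigr => j _; rewrite -mulr_sumr; congr (_ * _).
  rewrite /pcount -sum1_card natr_sum [RHS]big_mkcond; apply: eq_bigr => y _.
  by rewrite inE; case: ifP.
rewrite !MA; apply: eq_bigr => j _; congr (_ * _%:R).
have [_ drg] := e_drg.
have [p pE] := drg (Ordinal (vdist_lt u v)) j (Ordinal (D_gt0 : (1 < D.+1)%N)).
by rewrite !pE.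
Qed.

Lemma dist_const_exp k : dist_const (A ^+ k).
Proof.
elim: k => [|k IHk]; first by rewrite expr0; apply: dist_const1.
by rewrite exprSr; apply: dist_const_mul_adjmx.
Qed.

Lemma adjmx_tr : A^T = A.
Proof. by apply/matrixP => u v; rewrite !mxE; case: e_graph => ->. Qed.

(** The entries of A^k count walks of length k. This vanishing, with positivity when k is the
    distance, separates the distance classes when the dual eigenvalues are compared. *)
Lemma adjmx_exp_eq0 k u v : (k < vdist u v)%N -> (A ^+ k) u v = 0.
Proof.
elim: k u v => [|k IHk] u v k_lt.
  rewrite expr0 mxE; case: eqP k_lt => // ->.
  by rewrite /vdist ltnNge leqn0 dist_eq0 // eqxx.
rewrite exprSr mxE big1 // => w _; rewrite mxE.
have [ewv|_] := boolP (e _ _); last by rewrite mulr0.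
rewrite IHk ?mul0r //.
have := dist_triangle e_graph (enum_val u) (enum_val v) (enum_val w).
have /eqP -> : dist e (enum_val w) (enum_val v) == 1%N by rewrite dist_eq1.
by move: k_lt; rewrite /vdist; lia.
Qed.

Lemma adjmx_exp_ge0 k u v : 0 <= (A ^+ k) u v.
Proof.
elim: k u v => [|k IHk] u v; first by rewrite expr0 mxE ler0n.
by rewrite exprSr mxE sumr_ge0 // => w _; rewrite mulr_ge0 // mxE ler0n.
Qed.

Lemma adjmx_exp_dist_gt0 u v : 0 < (A ^+ vdist u v) u v.
Proof.
move: {2}(vdist u v) (erefl (vdist u v)) => d; elim: d u v => [|d IHd] u v duv.
  move/eqP: duv; rewrite /vdist dist_eq0 // (inj_eq enum_val_inj) => /eqP ->.
  have /eqP -> : dist e (enum_val v) (enum_val v) == 0 by rewrite dist_eq0.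
  by rewrite expr0 mxE eqxx ltr01.
have [w dw ewv] := dist_step e_graph duv.
rewrite duv exprSr mxE (bigD1 (enum_rank w)) //=.
apply: ltr_wpDr.
  by rewrite sumr_ge0 // => w' _; rewrite mulr_ge0 ?adjmx_exp_ge0 // mxE ler0n.
rewrite [A _ _]mxE enum_rankK ewv mulr1.
have duw : vdist u (enum_rank w) = d by rewrite /vdist enum_rankK.
by have := IHd _ _ duw; rewrite duw.
Qed.

Variable theta : 'I_D.+1 -> R.
Hypothesis theta_ord : eigenvalue_ordering theta.

Let theta_inj : injective theta. Proof. by case: theta_ord. Qed.

Local Notation E := (prim_idem theta).

(* The powers of A lie in the (D+1)-dimensional space of matrices that are
   constant on distance classes, so A has an annihilating polynomial of degree
   at most D + 1; the D + 1 eigenvalues determine it up to a scalar. *)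
Lemma adjmx_annul : poly_mx A (\prod_i ('X - (theta i)%:P)) = 0.
Proof.
pose C : 'M[R]_(D.+2, D.+1) := \matrix_(k, j) dist_value (A ^+ k) j.
have /rowV0Pn[a /sub_kermxP aC a_neq0] : kermx C != 0.
  rewrite kermx_eq0 -row_leq_rank -ltnNge ltnS; exact: rank_leq_col.
pose p := rVpoly a.
have p_le : (size p <= D.+2)%N by apply: size_poly.
have p_neq0 : p != 0.
  by apply: contraNneq a_neq0 => p0; rewrite -[a]rVpolyK -/p p0 linear0.
have pA : poly_mx A p = 0.
  apply/matrixP => u v; rewrite (poly_mx_wide _ p_le) summxE.
  transitivity ((a *m C) ord0 (Ordinal (vdist_lt u v))).
    rewrite mxE; apply: eq_bigr => k _; rewrite 2!mxE coef_rVpoly_ord.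
    by rewrite (dist_valueE _ _ (dist_const_exp k)).
  by rewrite aC !mxE.
have p_root i : root p (theta i).
  have [_ eigP _] := theta_ord.
  have /eigenvalueP[v vA v_neq0] : eigenvalue A (theta i) by apply/eigP; exists i.
  have := poly_mx_mull p vA; rewrite pA mulmx0 => /esym/eqP.
  by rewrite scaler_eq0 (negPf v_neq0) orbF.
have prodE : \prod_i ('X - (theta i)%:P) =
    \prod_(t <- [seq theta i | i <- enum 'I_D.+1]) ('X - t%:P).
  by rewrite big_map big_enum.
have dvd : \prod_i ('X - (theta i)%:P) %| p.
  rewrite prodE; apply: uniq_roots_dvdp.
    by apply/allP => _ /mapP[i _ ->].
  by rewrite uniq_rootsE map_inj_uniq ?enum_uniq.
have size_prod : size (\prod_i ('X - (theta i)%:P)) = D.+2.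
  by rewrite prodE size_prod_XsubC size_map size_enum_ord.
have : \prod_i ('X - (theta i)%:P) %= p.
  rewrite -dvdp_size_eqp // size_prod eqn_leq p_le andbT -size_prod.
  exact: dvdp_leq.
case/eqpP => -[c1 c2] /= /andP[c1_neq0 _] c1E.
apply/eqP; rewrite -(inj_eq (scalerI c1_neq0)) scaler0 -poly_mxZ c1E.
by rewrite poly_mxZ pA scaler0.
Qed.

Let L := lagrange_idem A theta.

(** The Lagrange idempotent is symmetric and acts as the identity on the eigenspace, which contains
    its rows. Hence every primitive idempotent is a polynomial in A. *)
Lemma prim_idemE i : E i = L i.
Proof.
apply: orth_proj_eq.
- by apply: lagrange_idem_tr; apply: adjmx_tr.
- apply/eigenspaceP; rewrite -[LHS]trmxK trmx_mul adjmx_tr.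
  rewrite (lagrange_idem_tr theta i adjmx_tr) (mul_lagrange_idem adjmx_annul).
  by rewrite linearZ /= (lagrange_idem_tr theta i adjmx_tr).
- have UA : eigenspace A (theta i) *m A = theta i *: eigenspace A (theta i).
    exact/eigenspaceP.
  apply/row_matrixP => k; rewrite row_mul (poly_mx_mull (a := theta i)).
    by rewrite lagrange_polyE ?eqxx ?scale1r.
  by rewrite -row_mul UA linearZ.
Qed.

Lemma prim_idem_mul i j : E i *m E j = if i == j then E i else 0.
Proof. by rewrite !prim_idemE lagrange_idem_mul //; apply: adjmx_annul. Qed.

Lemma prim_idem_sum : \sum_i E i = 1%:M.
Proof.
by rewrite -(lagrange_idem_sum A theta_inj); apply: eq_bigr => i _; apply: prim_idemE.
Qed.

Lemma prim_idem_tr i : (E i)^T = E i.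
Proof. by rewrite prim_idemE lagrange_idem_tr //; apply: adjmx_tr. Qed.

Lemma adjmx_mul_prim_idem i : A *m E i = theta i *: E i.
Proof. by rewrite prim_idemE mul_lagrange_idem //; apply: adjmx_annul. Qed.

Lemma adjmx_expE k : A ^+ k = \sum_i theta i ^+ k *: E i.
Proof.
elim: k => [|k IHk].
  transitivity (1%:M : 'M[R]_N); first by rewrite expr0.
  by rewrite -prim_idem_sum; apply: eq_bigr => i _; rewrite expr0 scale1r.
rewrite exprS IHk [LHS]mulmx_sumr; apply: eq_bigr => i _.
by rewrite -scalemxAr adjmx_mul_prim_idem scalerA -exprSr.
Qed.

Lemma dist_const_prim_idem i : dist_const (E i).
Proof.
rewrite prim_idemE; apply: (lin_closed_sum dist_const_lin) => k _.
by apply: (lin_closedZ dist_const_lin); apply: dist_const_exp.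
Qed.

(* For an eigenvector f of the valency, the sum of (f u - f w)^2 over the edges
   vanishes. *)
Lemma prim_idem0_const u v u' v' : E ord0 u v = E ord0 u' v'.
Proof.
have symE0 w w' : E ord0 w w' = E ord0 w' w.
  by rewrite -{1}[E ord0]prim_idem_tr mxE.
suff const_col w w' y : E ord0 w y = E ord0 w' y.
  by rewrite (const_col u u') symE0 (const_col v v') symE0.
pose f w := E ord0 w y; rewrite -![E ord0 _ y]/(f _).
have Af w1 : \sum_w2 A w1 w2 * f w2 = theta ord0 * f w1.
  have := congr1 (fun M : 'M_(_, _) => M w1 y) (adjmx_mul_prim_idem ord0).
  by rewrite mxE [RHS]mxE.
have degA w1 : \sum_w2 A w1 w2 = theta ord0.
  have [_ _ th0] := theta_ord; rewrite (th0 (enum_val w1)).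
  rewrite -sum1_card natr_sum [RHS]big_mkcond.
  rewrite [RHS](reindex (fun k : 'I_N => enum_val k)) /=; last first.
    exact/onW_bij/enum_val_bij.
  by apply: eq_bigr => w2 _; rewrite mxE inE; case: (e _ _).
have A_sym w1 w2 : A w1 w2 = A w2 w1 by rewrite -{1}adjmx_tr mxE.
have sum0 : \sum_w1 \sum_w2 A w1 w2 * (f w1 - f w2) ^+ 2 = 0.
  transitivity (\sum_w1 \sum_w2 (A w1 w2 * f w1 ^+ 2)
    + \sum_w1 \sum_w2 (A w2 w1 * f w2 ^+ 2)
    - 2 * \sum_w1 f w1 * \sum_w2 A w1 w2 * f w2).
    rewrite mulr_sumr -big_split -sumrB /=; apply: eq_bigr => w1 _.
    rewrite mulrA mulr_sumr -big_split -sumrB /=; apply: eq_bigr => w2 _.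
    by rewrite (A_sym w2 w1); ring.
  rewrite [X in _ + X - _]exchange_big /=.
  under eq_bigr do rewrite -mulr_suml degA.
  under [X in 2 * X]eq_bigr do rewrite Af.
  rewrite mulr_sumr -big_split -sumrB big1 //= => w1 _; ring.
have adj_eq w1 w2 : e (enum_val w1) (enum_val w2) -> f w1 = f w2.
  have term_ge0 w3 w4 : 0 <= A w3 w4 * (f w3 - f w4) ^+ 2.
    by rewrite mulr_ge0 ?sqr_ge0 // mxE ler0n.
  move=> ew; have sum1_0 := psumr_eq0P (P := predT)
    (F := fun w1 => \sum_w2 A w1 w2 * (f w1 - f w2) ^+ 2)
    (fun w3 _ => sumr_ge0 _ (fun w4 _ => term_ge0 w3 w4)) sum0 (i := w1) isT.
  have := psumr_eq0P (P := predT)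
    (F := fun w2 => A w1 w2 * (f w1 - f w2) ^+ 2)
    (fun w4 _ => term_ge0 w1 w4) sum1_0 (i := w2) isT.
  by rewrite mxE ew mul1r => /eqP; rewrite sqrf_eq0 subr_eq0 => /eqP.
have conn_eq x x' : f (enum_rank x) = f (enum_rank x').
  have [_ _ /(_ x x') /connectP[p xp ->]] := e_graph.
  elim: p x xp => //= z p IHp x /andP[exz /IHp <-].
  by apply: adj_eq; rewrite !enum_rankK.
by have := conn_eq (enum_val w) (enum_val w'); rewrite !enum_valK.
Qed.

Hypothesis E_Qpol : Q_polynomial E.

Let one : 'I_D.+1 := Ordinal (D_gt0 : (1 < D.+1)%N).

(** The usual dual eigenvalue divided by [#|X|], which changes neither distinctness nor the
    tridiagonal relations. *)
Definition dual_theta (k : 'I_D.+1) : R := dist_value (E one) k.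

(* If two dual eigenvalues coincided, the recurrence
   E_1 o E_i = |X|^-1 sum_(h <= i + 1) q^h_{1,i} E_h would force every E_i, and
   hence every power of A, to agree on two distance classes. *)
Lemma dual_theta_inj : injective dual_theta.
Proof.
suff ths_neq (j k : 'I_D.+1) : (j < k)%N -> dual_theta j <> dual_theta k.
  move=> j k jk; apply: val_inj.
  by case: (ltngtP j k) => // /ths_neq; rewrite jk.
move=> j_lt_k jk.
have pair_at d : (d <= D)%N -> exists u v, vdist u v = d.
  move=> d_le; have x0 : X.
    have [[x _] _|] := pickP (predT : pred (X * X)); first exact: x.
    move=> none; have := leq_trans D_gt0 (leqnn D).
    by rewrite /diameter big_pred0.
  have [y [z dyz]] := dist_onto e_graph x0 d_le.
  by exists (enum_rank y), (enum_rank z); rewrite /vdist !enum_rankK.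
have [u [v duv]] := pair_at j (ltn_ord j : (_ < D.+1)%N).
have [u' [v' duv']] := pair_at k (ltn_ord k : (_ < D.+1)%N).
pose agree (M : 'M[R]_N) := M u v = M u' v'.
have agree_lin : lin_closed agree.
  split=> [|a M M' aM aM']; rewrite /agree !mxE //.
  by move: aM aM'; rewrite /agree => -> ->.
have agree1 : agree (E one).
  rewrite /agree !(dist_valueE _ _ (dist_const_prim_idem one)) duv duv'.
  exact: jk.
have agreeE m (i : 'I_D.+1) : (i <= m)%N -> agree (E i).
  elim: m i => [|m IHm] i.
    rewrite leqn0 => /eqP i0; have -> : i = ord0 by apply: val_inj.
    exact: prim_idem0_const.
  rewrite leq_eqVlt => /orP[/eqP i_m|]; last exact: IHm.
  have m_lt : (m < D.+1)%N by have := ltn_ord i; rewrite i_m => /ltnW.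
  pose i' := Ordinal m_lt.
  have [q [q_eq qP]] := E_Qpol.
  have [_ q_neq0] := qP i one i'.
  have {}q_neq0 : q i one i' != 0 by apply: q_neq0; rewrite /= i_m add1n eqxx.
  have X_neq0 : #|X|%:R != 0 :> R.
    by rewrite pnatr_eq0 -lt0n; apply/card_gt0P; exists (enum_val u).
  (* The Krein expansion of the entrywise product of E_1 and E_m, solved for its top term E_(m+1);
     all later terms have coefficient 0. *)
  have Ei : E i = (q i one i')^-1 *: (#|X|%:R *: map2_mx *%R (E one) (E i')
      - \sum_(h | h != i) q h one i' *: E h).
    rewrite q_eq scalerA mulfV // scale1r (bigD1 i) //= addrK scalerA mulVf //.
    by rewrite scale1r.
  rewrite Ei; apply: (lin_closedZ agree_lin); apply: (lin_closedB agree_lin).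
    apply: (lin_closedZ agree_lin); rewrite /agree [LHS]mxE [RHS]mxE.
    by congr (_ * _); [exact: agree1 | apply: IHm].
  apply: (lin_closed_sum agree_lin) => h h_neq.
  have [h_le|h_gt] := leqP h m; first by apply: (lin_closedZ agree_lin); apply: IHm.
  have [q0 _] := qP h one i'; rewrite q0 ?scale0r; first exact: lin_closed0 agree_lin.
  rewrite -val_eqE /= i_m in h_neq.
  by rewrite /=; move: h_gt h_neq; lia.
(* The exponent is j, the smaller distance: A^j is positive at distance j and 0 at distance k. *)
have : agree (A ^+ vdist u v).
  rewrite adjmx_expE; apply: (lin_closed_sum agree_lin) => i _.
  by apply: (lin_closedZ agree_lin); apply: (agreeE D); apply: ltn_ord i.
rewrite /agree [RHS]adjmx_exp_eq0; last by rewrite duv duv'.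
by move/eqP; rewrite gt_eqF ?adjmx_exp_dist_gt0.
Qed.

(** * Dual idempotents and the dual pair of the graph *)

Variable x : X.
Local Notation Es := (dual_idem e R x).

Lemma dual_idemE k u v :
  Es k u v = ((u == v) && (dist e x (enum_val u) == k))%:R.
Proof. by rewrite mxE. Qed.

Lemma dual_idem_tr k : (Es k)^T = Es k.
Proof.
by apply/matrixP => u v; rewrite !mxE eq_sym; case: eqP => [->|].
Qed.

Lemma dual_idem_mulr (M : 'M[R]_N) k u v :
  (M *m Es k) u v = M u v * (dist e x (enum_val v) == k)%:R.
Proof.
rewrite mxE (bigD1 v) //= dual_idemE eqxx /= big1 ?addr0 // => w w_neq.
by rewrite dual_idemE (negPf w_neq) mulr0.
Qed.

Lemma dual_idem_mull (M : 'M[R]_N) k u v :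
  (Es k *m M) u v = (dist e x (enum_val u) == k)%:R * M u v.
Proof.
rewrite mxE (bigD1 u) //= dual_idemE eqxx /= big1 ?addr0 // => w w_neq.
by rewrite dual_idemE eq_sym (negPf w_neq) mul0r.
Qed.

Lemma dual_idem_mul (i j : 'I_D.+1) : Es i *m Es j = if i == j then Es i else 0.
Proof.
apply/matrixP => u v; rewrite dual_idem_mull.
have [->|i_neq] := eqVneq i j; rewrite !mxE.
  by case: (_ == v); case: (_ == _ :> nat); rewrite ?mulr1 ?mulr0.
rewrite -val_eqE /= in i_neq.
by have [->|_] := eqVneq (dist e x (enum_val u)) i;
   rewrite ?mul0r // (negPf i_neq) andbF mulr0.
Qed.

Lemma dual_idem_comb (c : nat -> R) u v :
  (\sum_(k < D.+1) c k *: Es k) u v = (u == v)%:R * c (dist e x (enum_val u)).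
Proof.
rewrite summxE.
rewrite (bigD1 (Ordinal (dist_leD e x (enum_val u) : (_ < D.+1)%N))) //=.
rewrite mxE dual_idemE eqxx andbT mulrC big1 ?addr0 // => k k_neq.
rewrite mxE dual_idemE; rewrite -val_eqE eq_sym /= in k_neq.
by rewrite (negPf k_neq) andbF mulr0.
Qed.

Lemma dual_idem_sum : \sum_(k < D.+1) Es k = 1%:M.
Proof.
apply/matrixP => u v.
have := dual_idem_comb (fun=> 1) u v; rewrite mulr1 => uvE.
rewrite [RHS]mxE -uvE; congr (fun_of_matrix _ u v).
by apply: eq_bigr => k _; rewrite scale1r.
Qed.

(** A^* is the diagonal matrix of row x of E_1, so the squared norm of the product is the (x,
    x)-entry of E_1 (E_i o E_j) E_1 with the entrywise product o. That is a multiple of the Krein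
    parameter q^1_{i,j}, which is 0 for |i - j| > 1. *)
Lemma prim_idem_dual_adjmx (i j : 'I_D.+1) : (1 < (i - j) + (j - i))%N ->
  E i *m (\sum_k dual_theta k *: Es k) *m E j = 0.
Proof.
move=> far; have -> : \sum_k dual_theta k *: Es k = diag_mx (row (enum_rank x) (E one)).
  apply/matrixP => u v; rewrite (dual_idem_comb (fun k => dist_value (E one) k)).
  rewrite 2!mxE (dist_valueE _ _ (dist_const_prim_idem one)) /vdist enum_rankK.
  by rewrite mulrC mulr_natr.
apply: mul_diag_proj_eq0; rewrite ?prim_idem_tr ?prim_idem_mul ?eqxx //.
have [q [q_eq qP]] := E_Qpol.
have [q0 _] := qP one i j.
have {}q0 : q one i j = 0 by apply: q0; rewrite /=; lia.
rewrite q_eq -scalemxAr mulmx_sumr big1 ?scaler0 ?mul0mx // => h _.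
rewrite -scalemxAr -row_mul prim_idem_mul.
by case: eqP => [<-|_]; [rewrite q0 scale0r | rewrite linear0 scaler0].
Qed.

(** Adjacent vertices have distances from x that differ by at most 1. *)
Lemma dual_idem_adjmx (i j : 'I_D.+1) : (1 < (i - j) + (j - i))%N ->
  Es i *m A *m Es j = 0.
Proof.
move=> far; apply/matrixP => u v.
rewrite dual_idem_mulr dual_idem_mull [A u v]mxE [RHS]mxE.
have [du|_] := eqVneq (dist e x (enum_val u)) i; last by rewrite !mul0r.
have [dv|_] := eqVneq (dist e x (enum_val v)) j; last by rewrite mulr0.
have [euv|_] := boolP (e _ _); last by rewrite mulr0 mul0r.
have := dist_triangle e_graph x (enum_val u) (enum_val v).
have := dist_triangle e_graph x (enum_val v) (enum_val u).
rewrite (dist_sym e_graph (enum_val v)) du dv.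
have /eqP -> : dist e (enum_val u) (enum_val v) == 1%N by rewrite dist_eq1.
by move: far; lia.
Qed.

Definition drg_idem (c : bool) (i : 'I_D.+1) : 'M[R]_N := if c then E i else Es i.
Definition drg_eigenvalue (c : bool) : 'I_D.+1 -> R := if c then theta else dual_theta.

Lemma drg_pw1 : pw drg_idem drg_eigenvalue true 1 = A.
Proof. by rewrite -[RHS]expr1 adjmx_expE. Qed.

Lemma drg_dual_pair : dual_pair drg_idem drg_eigenvalue.
Proof.
apply: dual_pair_of_tridiagonal => [c|c i j|c|c i|c i j far].
- by case: c; [exact: theta_inj | exact: dual_theta_inj].
- by case: c; [exact: prim_idem_mul | exact: dual_idem_mul].
- by case: c; [exact: prim_idem_sum | exact: dual_idem_sum].
- by case: c; [exact: prim_idem_tr | exact: dual_idem_tr].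
- case: c => /=; last by rewrite drg_pw1; apply: dual_idem_adjmx.
  have -> : pw drg_idem drg_eigenvalue false 1 = \sum_k dual_theta k *: Es k by [].
  exact: prim_idem_dual_adjmx.
Qed.

End DistanceRegular.

(** * Wedderburn decompositions *)
(** Comparison with the matrix units [delta_mx b p] suffices, also over noncommutative K. *)
Lemma central_scalar_mx (K : nzRingType) (m : nat) (c : 'M[K]_m) (p : 'I_m) :
  (forall G : 'M[K]_m, c *m G = G *m c) -> c = (c p p)%:M.
Proof.
move=> c_comm; apply/matrixP => a b; rewrite mxE.
have := congr1 (fun M : 'M_m => M a p) (c_comm (delta_mx b p)).
rewrite mxE (bigD1 b) //= mxE !eqxx mulr1 big1 => [|j j_neq]; last first.
  by rewrite mxE (negPf j_neq) mulr0.
rewrite addr0 mxE (bigD1 p) //= mxE eqxx andbT big1 => [|j j_neq]; last first.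
  by rewrite mxE (negPf j_neq) andbF mul0r.
by rewrite addr0 => ->; case: eqP => _; rewrite ?mul1r ?mul0r.
Qed.

Definition subalgebra (F : comNzRingType) (N : nat) (T : 'M[F]_N -> Prop) :=
  [/\ T 1%:M, lin_closed T & forall M M', T M -> T M' -> T (M *m M')].

Lemma gen_subalg_subalgebra (F : comNzRingType) (N : nat) (S : 'M[F]_N -> Prop) :
  subalgebra (gen_subalg S).
Proof.
have gen1 : gen_subalg S 1%:M by apply: gen_subalg1.
split=> [//||M M' SM SM']; last exact: gen_subalgM.
split=> [|a M M' SM SM']; first by rewrite -(scale0r 1%:M); apply: gen_subalgZ.
by apply: gen_subalgD => //; apply: gen_subalgZ.
Qed.

Section IsoMxSum.
Variables (F : fieldType) (N : nat) (T : 'M[F]_N -> Prop).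
Hypothesis T_alg : subalgebra T.
Variables (k : nat) (m : 'I_k -> nat) (K : 'I_k -> algType F).
Variable f : forall i : 'I_k, 'M[F]_N -> 'M[K i]_(m i).
(** The body of [iso_mx_sum] for a fixed family f, so that the lemmas below share one f. *)
Definition mx_sum_iso :=
  [/\ forall i, f i 1%:M = 1%:M,
      forall i a A B, T A -> T B ->
        f i (a *: A + B) = map_mx ( *:%R a) (f i A) + f i B,
      forall i A B, T A -> T B -> f i (A *m B) = f i A *m f i B,
      forall A B, T A -> T B -> (forall i, f i A = f i B) -> A = B &
      forall G : (forall i, 'M[K i]_(m i)),
        exists2 A, T A & forall i, f i A = G i].
Hypothesis f_iso : mx_sum_iso.

Let f1 i : f i 1%:M = 1%:M. Proof. by case: f_iso. Qed.
Let f_lin i a A B : T A -> T B ->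
  f i (a *: A + B) = map_mx ( *:%R a) (f i A) + f i B.
Proof. by case: f_iso => _ fl _ _ _; apply: fl. Qed.
Let f_mul i A B : T A -> T B -> f i (A *m B) = f i A *m f i B.
Proof. by case: f_iso => _ _ fm _ _; apply: fm. Qed.
Let f_inj A B : T A -> T B -> (forall i, f i A = f i B) -> A = B.
Proof. by case: f_iso => _ _ _ fi _; apply: fi. Qed.
Let f_surj (G : forall i, 'M[K i]_(m i)) :
  exists2 A, T A & forall i, f i A = G i.
Proof. by case: f_iso => _ _ _ _ fs; apply: fs. Qed.

Let T_lin : lin_closed T. Proof. by case: T_alg. Qed.
Let T_mul M M' : T M -> T M' -> T (M *m M').
Proof. by case: T_alg => _ _; apply. Qed.
Let T1 : T 1%:M. Proof. by case: T_alg. Qed.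

Lemma iso0 i : f i 0 = 0.
Proof.
have T0 : T 0 := lin_closed0 T_lin.
have := f_lin i 1 T0 T0; rewrite scaler0 addr0 => f0.
apply: (addrI (f i 0)); rewrite addr0 [RHS]f0; congr (_ + _).
by apply/matrixP => a b; rewrite mxE scale1r.
Qed.

Lemma isoZ i a A : T A -> f i (a *: A) = map_mx ( *:%R a) (f i A).
Proof.
move=> TA; rewrite -[a *: A]addr0 f_lin ?iso0 ?addr0 //.
exact: lin_closed0.
Qed.

Lemma isoD i A B : T A -> T B -> f i (A + B) = f i A + f i B.
Proof.
move=> TA TB; rewrite -[A]scale1r f_lin // scale1r; congr (_ + _).
by apply/matrixP => a b; rewrite mxE scale1r.
Qed.

Lemma iso_sum (I : Type) (r : seq I) (P : pred I) (g : I -> 'M[F]_N) i :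
  (forall j, P j -> T (g j)) ->
  f i (\sum_(j <- r | P j) g j) = \sum_(j <- r | P j) f i (g j).
Proof.
move=> Tg; suff [] : T (\sum_(j <- r | P j) g j) /\
  f i (\sum_(j <- r | P j) g j) = \sum_(j <- r | P j) f i (g j) by [].
elim/big_rec2: _ => [|j y1 y2 /Tg Tj [Ty2 <-]].
  by split; [apply: lin_closed0 | apply: iso0].
by split; [apply: lin_closedD | rewrite isoD].
Qed.

(** The two-sided ideal of T that corresponds to the i-th summand. *)
Definition in_block i t := T t /\ forall j, i != j -> f j t = 0.

Lemma iso_block i (G : 'M[K i]_(m i)) : exists2 t, in_block i t & f i t = G.
Proof.
have [t Tt ft] := f_surj (dfwith (fun j => 0 : 'M[K j]_(m j)) G).
exists t; last by rewrite ft dfwith_in.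
by split=> // j i_neq_j; rewrite ft dfwith_out.
Qed.

Lemma in_block_inj i t t' : in_block i t -> in_block i t' -> f i t = f i t' -> t = t'.
Proof.
move=> [Tt bt] [Tt' bt'] ftt'; apply: f_inj => // j.
by have [<-//|i_neq_j] := eqVneq i j; rewrite bt ?bt'.
Qed.

Lemma in_block_lin i : lin_closed (in_block i).
Proof.
split=> [|a t t' [Tt bt] [Tt' bt']].
  by split=> [|j _]; [apply: lin_closed0 | apply: iso0].
split=> [|j i_neq_j]; first by case: T_lin => _; apply.
rewrite f_lin // bt // bt' // addr0.
by apply/matrixP => p q; rewrite !mxE scaler0.
Qed.

Lemma in_block_mull i t t' : T t -> in_block i t' -> in_block i (t *m t').
Proof.
move=> Tt [Tt' bt']; split=> [|j i_neq_j]; first exact: T_mul.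
by rewrite f_mul // bt' // mulmx0.
Qed.

Lemma in_block_mulr i t t' : in_block i t -> T t' -> in_block i (t *m t').
Proof.
move=> [Tt bt] Tt'; split=> [|j i_neq_j]; first exact: T_mul.
by rewrite f_mul // bt // mul0mx.
Qed.

(** The units of these ideals: orthogonal central idempotents with sum 1. *)
Definition block_units (z : 'I_k -> 'M[F]_N) :=
  forall i, in_block i (z i) /\ f i (z i) = 1%:M.

Lemma block_units_exist : exists z, block_units z.
Proof.
suff : forall i, exists t, in_block i t /\ f i t = 1%:M.
  by move=> /fin_all_exists[z z_units]; exists z.
by move=> i; have [t bt ft] := iso_block (1%:M : 'M[K i]_(m i)); exists t.
Qed.

Variable z : 'I_k -> 'M[F]_N.
Hypothesis z_units : block_units z.

Let z_block i : in_block i (z i). Proof. by case: (z_units i). Qed.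
Let fz i : f i (z i) = 1%:M. Proof. by case: (z_units i). Qed.
Let Tz i : T (z i). Proof. by case: (z_block i). Qed.

Lemma block_id_mull i t : in_block i t -> z i *m t = t.
Proof.
move=> bt; apply: (@in_block_inj i) => //.
  by apply: in_block_mull.
by case: bt => Tt _; rewrite f_mul // fz mul1mx.
Qed.

Lemma block_id_mulr i t : in_block i t -> t *m z i = t.
Proof.
move=> bt; apply: (@in_block_inj i) => //.
  by apply: in_block_mulr.
by case: bt => Tt _; rewrite f_mul // fz mulmx1.
Qed.

Lemma block_id_comm i t : T t -> z i *m t = t *m z i.
Proof.
move=> Tt; apply: (@in_block_inj i); first exact: in_block_mulr.
  exact: in_block_mull.
by rewrite !f_mul // fz mul1mx mulmx1.
Qed.

Lemma block_id_orth i j : i != j -> z i *m z j = 0.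
Proof.
move=> i_neq_j; apply: f_inj => [||l]; first exact: T_mul.
  exact: lin_closed0.
rewrite f_mul // iso0; have [i_l|i_neq_l] := eqVneq i l.
  by case: (z_block j) => _ ->; rewrite ?mulmx0 // -i_l eq_sym.
by case: (z_block i) => _ ->; rewrite ?mul0mx.
Qed.

Lemma block_id_sum : \sum_i z i = 1%:M.
Proof.
apply: f_inj => [||l]; first by apply: (lin_closed_sum T_lin).
  exact: T1.
rewrite f1 iso_sum // (bigD1 l) //= fz big1 ?addr0 // => i i_neq_l.
by case: (z_block i) => _ ->.
Qed.

Lemma block_id_neq0 i : (0 < m i)%N -> z i != 0.
Proof.
move=> m_gt0; apply/eqP => z0; have := fz i; rewrite z0 iso0 => /matrixP.
move/(_ (Ordinal m_gt0) (Ordinal m_gt0)); rewrite !mxE eqxx => /esym/eqP.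
by rewrite oner_eq0.
Qed.

Lemma block_center i c : (0 < m i)%N -> T c ->
    (forall t, T t -> c *m t = t *m c) ->
  exists a : K i, f i c = a%:M.
Proof.
move=> m_gt0 Tc c_comm; exists (f i c (Ordinal m_gt0) (Ordinal m_gt0)).
apply: central_scalar_mx => G; have [t [Tt _] <-] := iso_block G.
by rewrite -!f_mul // c_comm.
Qed.

(** A central element acts on the block as a scalar of K i, and here K i consists of the multiples
    of 1. *)
Lemma block_center_scalar i c : (0 < m i)%N ->
    (forall b : K i, exists a : F, b = a *: 1) -> T c ->
    (forall t, T t -> c *m t = t *m c) ->
  exists a : F, c *m z i = a *: z i.
Proof.
move=> m_gt0 K1 Tc c_comm; have [b fc] := block_center m_gt0 Tc c_comm.
have [a b_a] := K1 b; exists a.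
apply: (@in_block_inj i); first by apply: in_block_mull.
  exact: (lin_closedZ (in_block_lin i)).
rewrite f_mul // fz mulmx1 isoZ // fz fc b_a.
by apply/matrixP => p q; rewrite !mxE; case: eqP; rewrite ?scaler0.
Qed.

End IsoMxSum.

(** * Blocks of a real algebra closed under transposition *)

Section RealBlocks.
Variables (R : realFieldType) (N : nat) (T : 'M[R]_N -> Prop).
Hypothesis T_alg : subalgebra T.
Hypothesis T_tr : forall t, T t -> T t^T.
Variables (k : nat) (m : 'I_k -> nat) (K : 'I_k -> algType R).
Variable f : forall i : 'I_k, 'M[R]_N -> 'M[K i]_(m i).
Hypothesis f_iso : mx_sum_iso T f.
Variable z : 'I_k -> 'M[R]_N.
Hypothesis z_units : block_units T f z.
Hypothesis m_gt0 : forall i, (0 < m i)%N.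
Hypothesis K_div : forall i (b : K i), b != 0 -> exists b', b' * b = 1.

Let T_mul M M' : T M -> T M' -> T (M *m M').
Proof. by case: T_alg => _ _; apply. Qed.
Let Tz i : T (z i). Proof. by case: (z_units i) => -[]. Qed.
Let f_mul i A B : T A -> T B -> f i (A *m B) = f i A *m f i B.
Proof. by case: f_iso => _ _ fm _ _; apply: fm. Qed.

Lemma block_id_idem i : z i *m z i = z i.
Proof. by apply: (block_id_mull T_alg f_iso z_units); case: (z_units i). Qed.

(* f i maps (z i)^T to a central idempotent of a matrix algebra over a division
   ring, and it is not 0 because (z i)^T z i <> 0. *)
Lemma block_id_tr i : (z i)^T = z i.
Proof.
pose c := (z i)^T.
have Tc : T c by apply: T_tr.
have c_comm t : T t -> c *m t = t *m c.
  move=> Tt; apply: trmx_inj; rewrite !trmx_mul trmxK.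
  by apply/esym/(block_id_comm T_alg f_iso z_units); apply: T_tr.
have [b fc] := block_center f_iso (m_gt0 i) Tc c_comm.
have cz_neq0 : c *m z i != 0.
  apply: contraNneq (block_id_neq0 T_alg f_iso z_units (m_gt0 i)) => cz0.
  rewrite -[z i]trmxK; apply/eqP; rewrite (_ : (z i)^T = 0) ?trmx0 //.
  by apply: mulmx_tr_eq0; rewrite trmxK cz0 mxtrace0.
have bz : in_block T f i (z i) by case: (z_units i).
have fcz : f i (c *m z i) = b%:M.
  by rewrite f_mul // fc; case: (z_units i) => _ ->; rewrite mulmx1.
have b_neq0 : b != 0.
  apply: contraNneq cz_neq0 => b0; apply/eqP.
  apply: (in_block_inj f_iso (i := i)); first exact: in_block_mull.
    exact: lin_closed0 (in_block_lin T_alg f_iso i).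
  by rewrite fcz b0 (iso0 T_alg f_iso) raddf0.
have bb : b * b = b.
  have cc : c *m c = c by rewrite -trmx_mul block_id_idem.
  have := congr1 (f i) cc; rewrite f_mul // fc -scalar_mxM => /matrixP.
  move/(_ (Ordinal (m_gt0 i)) (Ordinal (m_gt0 i))).
  by rewrite !mxE eqxx.
have b1 : b = 1.
  have [b' b'b] := K_div b_neq0.
  by rewrite -[b]mul1r -{1}b'b -mulrA bb.
have cz : c *m z i = z i.
  apply: (in_block_inj f_iso (i := i)) => //; first exact: in_block_mull.
  by rewrite fcz b1; case: (z_units i).
have := congr1 trmx cz.
by rewrite trmx_mul trmxK -/c cz => <-.
Qed.

(* If the entry g of f i e at (q, p) is non-zero, then the matrices
   f i e * delta_mx p q (b / g) * f i e multiply like the elements b of K i. *)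
Lemma block_no_imaginary i (e : 'M[R]_N) (iota : K i) :
    T e -> e != 0 -> e *m e = e -> e *m z i = e ->
    (forall t, T t -> (e *m t *m e)^T = e *m t *m e) ->
  iota * iota <> - 1.
Proof.
move=> Te e_neq0 ee ez eTe_tr iota2.
have be : in_block T f i e.
  by rewrite -ez; apply: (in_block_mull T_alg f_iso) => //; case: (z_units i).
pose G := f i e.
have GG : G *m G = G by rewrite -f_mul // ee.
have [q [p g_neq0]] : exists q, exists p, G q p != 0.
  have : G != 0.
    apply: contraNneq e_neq0 => G0; apply/eqP.
    apply: (in_block_inj f_iso (i := i)) => //.
      exact: lin_closed0 (in_block_lin T_alg f_iso i).
    by rewrite (iso0 T_alg f_iso).
  move=> G_neq0; have [/existsP[q /existsP[p]]|none] :=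
    boolP [exists q, exists p, G q p != 0]; first by exists q, p.
  case/eqP: G_neq0; apply/matrixP => q p; rewrite mxE; apply/eqP.
  by apply: contraNT none => g_neq0; apply/existsP; exists q; apply/existsP; exists p.
have [g' g'g] := K_div g_neq0.
(* A copy of K i inside the corner cut out by G: the factor [g'] cancels the entry [G q p] that
   arises in a product. *)
pose H (b : K i) : 'M[K i]_(m i) := \matrix_(a, c) (G a p * (b * g') * G q c).
have HM b b' : H b *m H b' = H (b * b').
  apply/matrixP => a c; rewrite !mxE.
  transitivity (\sum_j (G a p * (b * g')) * (G q j * G j p) * (b' * g' * G q c)).
    by apply: eq_bigr => j _; rewrite !mxE !mulrA.
  rewrite -mulr_suml -mulr_sumr.
  have -> : \sum_j G q j * G j p = G q p by rewrite -[in RHS]GG mxE.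
  by rewrite !mulrA -(mulrA _ g' (G q p)) g'g mulr1.
have GH b : G *m H b = H b.
  apply/matrixP => a c; rewrite !mxE.
  under eq_bigr do rewrite mxE !mulrA.
  by rewrite -!mulr_suml !mulrA; do 3![congr (_ * _)]; rewrite -[in RHS]GG mxE.
have HG b : H b *m G = H b.
  apply/matrixP => a c; rewrite !mxE.
  under eq_bigr do rewrite mxE -mulrA.
  by rewrite -mulr_sumr; congr (_ * _); rewrite -[in RHS]GG mxE.
(* Preimages in the block of matrices fixed by G on both sides lie in e T e and are therefore
   symmetric. *)
have sym_lift b : exists t, [/\ in_block T f i t, f i t = H b & t^T = t].
  have [t bt ft] := iso_block f_iso (H b); exists t; split=> //.
  have Tt : T t by case: bt.
  have -> : t = e *m t *m e; last exact: eTe_tr.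
  apply: (in_block_inj f_iso bt).
    by apply: (in_block_mull T_alg f_iso) => //; apply: T_mul.
  by rewrite !f_mul ?ft ?GH ?HG //; apply: T_mul.
have [u [bu fu tru]] := sym_lift 1; have [v [bv fv trv]] := sym_lift iota.
have Tu : T u by case: bu.
have Tv : T v by case: bv.
have uu : u *m u = u.
  apply: (in_block_inj f_iso _ bu); first exact: in_block_mull.
  by rewrite f_mul // fu HM mulr1.
have vv : v *m v + u = 0.
  apply: (in_block_inj f_iso (i := i)).
  - by apply: (lin_closedD (in_block_lin T_alg f_iso i)) => //; apply: in_block_mull.
  - exact: lin_closed0 (in_block_lin T_alg f_iso i).
  rewrite (isoD f_iso i (T_mul Tv Tv) Tu) f_mul // fu fv HM iota2 (iso0 T_alg f_iso).
  by apply/matrixP => a c; rewrite !mxE mulNr mulrN mul1r mulNr addNr.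
(* Since u and v are symmetric, tr (u u^T) = tr u = - tr (v v^T) <= 0. *)
have u0 : u = 0.
  have tr_ge0 (w : 'M[R]_N) : 0 <= \tr (w *m w^T).
    apply: sumr_ge0 => a _; rewrite mxE; apply: sumr_ge0 => c _.
    by rewrite mxE -expr2 sqr_ge0.
  apply: mulmx_tr_eq0; apply: le_anti; rewrite tr_ge0 andbT.
  rewrite tru uu; have := tr_ge0 v; rewrite trv.
  by move: (congr1 mxtrace vv); rewrite raddfD /= mxtrace0; lra.
(* The image of u has the nonzero entry [G q p] at (q, p). *)
have := congr1 (fun M : 'M_(m i) => M q p) fu.
rewrite u0 (iso0 T_alg f_iso) !mxE mul1r -mulrA g'g mulr1 => /esym/eqP.
by rewrite (negPf g_neq0).
Qed.

End RealBlocks.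

(** * Comparison of the real and complex blocks *)

Lemma linear_bij_size (C : fieldType) (m n : nat) (g : 'M[C]_m -> 'M[C]_n) :
    linear g -> (forall c, g c = 0 -> c = 0) ->
    (forall G, exists c, g c = G) ->
  m = n.
Proof.
move=> g_lin g_inj g_surj.
pose gl : {linear 'M[C]_m -> 'M[C]_n} :=
  HB.pack g (GRing.isLinear.Build C _ _ _ g g_lin).
have m_le : (m * m <= n * n)%N.
  have : row_free (lin_mx gl).
    rewrite -kermx_eq0; apply/rowV0P => v /sub_kermxP.
    rewrite -[v]vec_mxK mul_vec_lin => /(congr1 vec_mx).
    by rewrite mxvecK linear0 => /g_inj ->; rewrite linear0.
  by rewrite /row_free => /eqP <-; apply: rank_leq_col.
have n_le : (n * n <= m * m)%N.
  have : row_full (lin_mx gl).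
    rewrite -sub1mx; apply/row_subP => k.
    have [c gc] := g_surj (vec_mx (row k 1%:M)).
    by rewrite -[row k _]vec_mxK -gc -(mul_vec_lin gl) submxMl.
  by rewrite /row_full => /eqP <-; apply: rank_leq_row.
move: m_le n_le; rewrite !mulnn !leq_sqr => m_le n_le.
by apply/eqP; rewrite eqn_leq m_le.
Qed.

Section Complexification.
Variables (R : rcfType) (N : nat).
Local Notation C := R[i].
Local Notation cx := (map_mx (real_complex R)).

Lemma complexify_inj (a b : 'M[R]_N) : cx a + 'i%C *: cx b = 0 -> a = 0 /\ b = 0.
Proof.
move=> ab0; have abE u v : a u v = 0 /\ b u v = 0.
  have := congr1 (fun M : 'M[C]_N => M u v) ab0.
  by rewrite !mxE; simpc => -[-> ->].
by split; apply/matrixP => u v; rewrite mxE; case: (abE u v).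
Qed.

Variables (TR : 'M[R]_N -> Prop) (TC : 'M[C]_N -> Prop).
Hypotheses (TR_alg : subalgebra TR) (TC_alg : subalgebra TC).
Hypothesis TR_cx : forall a, TR a -> TC (cx a).
Hypothesis TC_split : forall M, TC M ->
  exists a b, [/\ TR a, TR b & M = cx a + 'i%C *: cx b].

Variables (l : nat) (m : 'I_l -> nat) (K : 'I_l -> algType R).
Variable f : forall i : 'I_l, 'M[R]_N -> 'M[K i]_(m i).
Hypothesis f_iso : mx_sum_iso TR f.
Hypothesis m_gt0 : forall i, (0 < m i)%N.
Hypothesis K1 : forall i (b : K i), exists a : R, b = a *: 1.
Variable z : 'I_l -> 'M[R]_N.
Hypothesis z_units : block_units TR f z.

Variables (h : nat) (n : 'I_h -> nat).
Variable g : forall j : 'I_h, 'M[C]_N -> 'M[C^o]_(n j).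
Hypothesis g_iso : mx_sum_iso TC (K := fun _ => C^o) g.
Hypothesis n_gt0 : forall j, (0 < n j)%N.
Variable w : 'I_h -> 'M[C]_N.
Hypothesis w_units : block_units TC (K := fun _ => C^o) g w.

Let Tz i : TR (z i). Proof. by case: (z_units i) => -[]. Qed.
Let Tw j : TC (w j). Proof. by case: (w_units j) => -[]. Qed.
Let Tcz i : TC (cx (z i)). Proof. exact: TR_cx. Qed.

Let zz i : z i *m z i = z i.
Proof. by apply: (block_id_mull TR_alg f_iso z_units); case: (z_units i). Qed.
Let ww j : w j *m w j = w j.
Proof. by apply: (block_id_mull TC_alg g_iso w_units); case: (w_units j). Qed.
Let czz i : cx (z i) *m cx (z i) = cx (z i).
Proof. by rewrite -map_mxM zz. Qed.

Lemma cx_block_id_comm i M : TC M -> cx (z i) *m M = M *m cx (z i).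
Proof.
move=> /TC_split[a [b [TRa TRb ->]]].
rewrite mulmxDr mulmxDl -scalemxAr -scalemxAl -!map_mxM.
by rewrite !(block_id_comm TR_alg f_iso z_units).
Qed.

(** The real and imaginary parts of a central element of [TC] are central in [TR], hence real
    scalars on each real block. *)
Lemma center_mul_block_id i c : TC c -> (forall t, TC t -> c *m t = t *m c) ->
  exists a : C, c *m cx (z i) = a *: cx (z i).
Proof.
move=> Tc c_comm; have [a [b [TRa TRb c_ab]]] := TC_split Tc.
have ab_comm t : TR t -> a *m t = t *m a /\ b *m t = t *m b.
  move=> Tt; have : cx (a *m t - t *m a) + 'i%C *: cx (b *m t - t *m b) = 0.
    rewrite !map_mxB !map_mxM scalerBr addrACA -opprD.
    rewrite scalemxAl scalemxAr -mulmxDl -mulmxDr -c_ab c_comm ?subrr //.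
    exact: TR_cx.
  by move=> /complexify_inj[/eqP at_ta /eqP bt_tb]; split; apply/eqP;
     rewrite -subr_eq0.
have [|al az] := block_center_scalar TR_alg f_iso z_units (m_gt0 i) (@K1 i) TRa.
  by move=> t /ab_comm[].
have [|be bz] := block_center_scalar TR_alg f_iso z_units (m_gt0 i) (@K1 i) TRb.
  by move=> t /ab_comm[].
exists (al%:C + 'i * be%:C)%C.
rewrite c_ab mulmxDl -scalemxAl -!map_mxM az bz !map_mxZ /=.
by rewrite scalerDl scalerA.
Qed.

Lemma idem_scale (V : lmodType C) (v : V) (a : C) :
  v != 0 -> a != 0 -> a *: v = (a * a) *: v -> a = 1.
Proof.
move=> v_neq0 a_neq0 av; apply: (mulfI a_neq0); rewrite mulr1; apply/esym/eqP.
have /eqP : (a - a * a) *: v = 0 by rewrite scalerBl -av subrr.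
by rewrite scaler_eq0 (negPf v_neq0) orbF subr_eq0.
Qed.

(** The product is a multiple of each of the two units; idempotence forces both nonzero factors to
    be 1. *)
Lemma block_ids_eq i j : w j *m cx (z i) != 0 -> cx (z i) = w j.
Proof.
move=> wz_neq0.
have cz_neq0 : cx (z i) != 0.
  by apply: contraNneq wz_neq0 => ->; rewrite mulmx0.
have w_neq0 : w j != 0.
  by apply: contraNneq wz_neq0 => ->; rewrite mul0mx.
have w_comm t : TC t -> w j *m t = t *m w j.
  exact: (block_id_comm TC_alg g_iso w_units).
have [a wz_a] := center_mul_block_id i (Tw j) w_comm.
have [|b zw_b] := block_center_scalar TC_alg g_iso w_units (n_gt0 j) _ (Tcz i)
  (@cx_block_id_comm i).
  by move=> b; exists b; rewrite /GRing.scale /= mulr1.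
have a1 : a = 1.
  apply: (@idem_scale _ (cx (z i))) => //.
    by apply: contraNneq wz_neq0 => a0; rewrite wz_a a0 scale0r.
  by rewrite -scalerA -wz_a scalemxAr -wz_a mulmxA ww.
have b1 : b = 1.
  apply: (@idem_scale _ (w j)) => //.
    by apply: contraNneq wz_neq0 => b0; rewrite -cx_block_id_comm // zw_b b0 scale0r.
  by rewrite -scalerA -zw_b scalemxAr -zw_b mulmxA czz.
by rewrite -[LHS]scale1r -a1 -wz_a -cx_block_id_comm // zw_b b1 scale1r.
Qed.

(** The units [w j] sum to 1, so some product [w j *m cx (z i)] is not 0. *)
Lemma block_id_real_complex i : exists j, cx (z i) = w j.
Proof.
have cz_neq0 : cx (z i) != 0.
  by rewrite map_mx_eq0; apply: (block_id_neq0 TR_alg f_iso z_units).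
have [j wz|none] := pickP (fun j => w j *m cx (z i) != 0).
  by exists j; apply: block_ids_eq.
case/eqP: cz_neq0; rewrite -[LHS]mul1mx -(block_id_sum TC_alg g_iso w_units).
by rewrite mulmx_suml big1 // => j _; have /negbFE/eqP := none j.
Qed.

Lemma block_id_complex_real j : exists i, cx (z i) = w j.
Proof.
have w_neq0 : w j != 0 by apply: (block_id_neq0 TC_alg g_iso w_units).
have [i wz|none] := pickP (fun i => w j *m cx (z i) != 0).
  by exists i; apply: block_ids_eq.
case/eqP: w_neq0; rewrite -[LHS]mulmx1 -(map_mx1 (real_complex R)).
rewrite -(block_id_sum TR_alg f_iso z_units) map_mx_sum mulmx_sumr big1 // => i _.
by have /negbFE/eqP := none i.
Qed.

(** Lifted matrix units form a real basis of the block of [TR], and a complex basis of the matching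
    block of [TC]; comparing dimensions gives equal squares of the sizes. *)
Lemma block_size_eq i j : cx (z i) = w j -> m i = n j.
Proof.
move=> zw.
have : forall pq : 'I_(m i) * 'I_(m i), exists t,
    in_block TR f i t /\ f i t = delta_mx pq.1 pq.2.
  move=> pq.
    have [t bt ft] := iso_block f_iso (delta_mx pq.1 pq.2 : 'M[K i]_(m i)).
    by exists t.
move=> /fin_all_exists[u u_spec].
(* The inverse of f i on the block, with real scalars in place of K i. *)
pose rc (a : 'M[R]_(m i)) := \sum_pq a pq.1 pq.2 *: u pq.
have rc_block a : in_block TR f i (rc a).
  apply: (lin_closed_sum (in_block_lin TR_alg f_iso i)) => pq _.
  by apply: (lin_closedZ (in_block_lin TR_alg f_iso i)); case: (u_spec pq).
have TR_lin : lin_closed TR by case: TR_alg.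
have f_rc a : f i (rc a) = \matrix_(p, q) (a p q *: 1).
  rewrite /rc (iso_sum TR_alg f_iso) => [|pq _]; last first.
    by apply: (lin_closedZ TR_lin); case: (u_spec pq) => -[].
  apply/matrixP => p q; rewrite summxE (bigD1 (p, q)) //= big1 => [|[p' q'] pq_neq].
    have [[Tu _] fu] := u_spec (p, q).
    by rewrite (isoZ TR_alg f_iso) // fu !mxE !eqxx addr0.
  have [[Tu _] fu] := u_spec (p', q').
  rewrite (isoZ TR_alg f_iso) // fu !mxE /=.
  move: pq_neq; rewrite xpair_eqE negb_and eq_sym (eq_sym q').
  by case: eqP; case: eqP => //= _ _; rewrite scaler0.
have rc_eq0 a : rc a = 0 -> a = 0.
  move=> rc0; apply/matrixP => p q; rewrite mxE.
  have := congr1 (fun M : 'M_(m i) => M p q) (f_rc a).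
  rewrite rc0 (iso0 TR_alg f_iso) !mxE => /esym/eqP.
  by rewrite scaler_eq0 oner_eq0 orbF => /eqP.
have rc_onto a : TR a -> exists al, a *m z i = rc al.
  move=> TRa; have /fin_all_exists[al al_spec] :
      forall pq : 'I_(m i) * 'I_(m i), exists al : R, f i a pq.1 pq.2 = al *: 1.
    by move=> pq; apply: K1.
  exists (\matrix_(p, q) al (p, q)); apply: (in_block_inj f_iso (i := i)) => //.
    by apply: (in_block_mull TR_alg f_iso) => //; case: (z_units i).
  rewrite f_rc; case: (f_iso) => _ _ -> // _ _.
  case: (z_units i) => _ ->; rewrite mulmx1.
  by apply/matrixP => p q; rewrite !mxE -al_spec.
(* The complex-linear extension of [rc]; [ccE] makes its linearity visible. *)
pose cc (c : 'M[C]_(m i)) := cx (rc (map_mx (@complex.Re R) c))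
  + 'i%C *: cx (rc (map_mx (@complex.Im R) c)).
have ccE c : cc c = \sum_pq c pq.1 pq.2 *: cx (u pq).
  rewrite /cc /rc !map_mx_sum scaler_sumr -big_split; apply: eq_bigr => pq _ /=.
  rewrite !map_mxZ !mxE scalerA -scalerDl; congr (_ *: _).
  by case: (c pq.1 pq.2) => x y; simpc.
have cc_block c : in_block TC (K := fun _ => C^o) g j (cc c).
  have -> : cc c = cc c *m w j.
    rewrite -zw /cc mulmxDl -scalemxAl -!map_mxM.
    by rewrite !(block_id_mulr TR_alg f_iso z_units).
  apply: (in_block_mull TC_alg g_iso); last by case: (w_units j).
  case: (TC_alg) => _ TC_lin _; apply: (lin_closedD TC_lin).
    by apply: TR_cx; case: (rc_block (map_mx (@complex.Re R) c)).
  apply: (lin_closedZ TC_lin).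
  by apply: TR_cx; case: (rc_block (map_mx (@complex.Im R) c)).
apply: (@linear_bij_size C _ _ (fun c => g j (cc c) : 'M[C]_(n j))).
- move=> a c c'; have -> : cc (a *: c + c') = a *: cc c + cc c'.
    rewrite !ccE scaler_sumr -big_split; apply: eq_bigr => pq _ /=.
    by rewrite !mxE scalerDl scalerA.
  case: (g_iso) => _ -> //; [|by case: (cc_block c)|by case: (cc_block c')].
  by move=> _ _ _; congr (_ + _); apply/matrixP => p q; rewrite !mxE.
- move=> c gc0; have : cc c = 0.
    apply: (in_block_inj g_iso (cc_block c)); last first.
      by rewrite (iso0 TC_alg g_iso).
    exact: lin_closed0 (in_block_lin TC_alg g_iso j).
  case/complexify_inj => /rc_eq0 Re0 /rc_eq0 Im0; apply/matrixP => p q.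
  have := congr1 (fun M : 'M_(m i) => M p q) Re0.
  have := congr1 (fun M : 'M_(m i) => M p q) Im0.
  by rewrite !mxE; case: (c p q) => x y /= -> ->.
- move=> G0; have [t bt <-] := iso_block g_iso (i := j) G0.
  have [Tt _] := bt; have [a [b [TRa TRb t_ab]]] := TC_split Tt.
  have [al al_a] := rc_onto _ TRa; have [be be_b] := rc_onto _ TRb.
  exists (\matrix_(p, q) (al p q +i* be p q)%C); congr (g j _).
  rewrite -(block_id_mulr TC_alg g_iso w_units bt) -zw t_ab mulmxDl -scalemxAl.
  rewrite -!map_mxM al_a be_b /cc.
  by congr (cx (rc _) + _ *: cx (rc _)); apply/matrixP => p q; rewrite !mxE.
Qed.

End Complexification.

(** * Division algebras and the two Terwilliger algebras *)

Lemma gen_subalg_tr (F : comNzRingType) (N : nat) (S : 'M[F]_N -> Prop) :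
  (forall M, S M -> M^T = M) -> forall M, gen_subalg S M -> gen_subalg S M^T.
Proof.
move=> S_tr M; elim=> {M} [M SM||M M' _ SM _ SM'|a M _ SM|M M' _ SM _ SM'].
- by rewrite S_tr //; apply: gen_subalg_gen.
- by rewrite trmx1; apply: gen_subalg1.
- by rewrite linearD; apply: gen_subalgD.
- by rewrite linearZ; apply: gen_subalgZ.
- by rewrite trmx_mul; apply: gen_subalgM.
Qed.

(** The inverse of a quaternion is its conjugate divided by the norm, a sum of four squares that
    vanishes only at 0. *)
Lemma real_div_alg_inv (R : realType) (d : real_div_alg)
    (b : real_div_alg_sort R d) :
  b != 0 -> exists b', b' * b = 1.
Proof.
case: d b => /= b b_neq0.
- by exists (b^-1 : R); apply: mulVf.
- by exists (b^-1 : R[i]); apply: mulVf.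
case: b b_neq0 => x y s t b_neq0.
pose N := x ^+ 2 + y ^+ 2 + s ^+ 2 + t ^+ 2.
have N_neq0 : N != 0.
  apply: contraNneq b_neq0 => N0.
  have [x2 y2 s2 t2] : [/\ x ^+ 2 = 0, y ^+ 2 = 0, s ^+ 2 = 0 & t ^+ 2 = 0].
    have := (sqr_ge0 x, sqr_ge0 y, sqr_ge0 s, sqr_ge0 t).
    by case=> -[[]]; move: N0; rewrite /N => ? ? ? ? ?; split; lra.
  move/eqP: x2; move/eqP: y2; move/eqP: s2; move/eqP: t2.
  by rewrite !sqrf_eq0 => /eqP -> /eqP -> /eqP -> /eqP ->.
exists (Quat (x / N) (- y / N) (- s / N) (- t / N)).
rewrite -[LHS]/(quat_mul _ _) -[RHS]/(quat1 R) /quat_mul /quat1 /=.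
by congr Quat; rewrite /N in N_neq0 *; field.
Qed.

Lemma real_div_alg_imaginary (R : realType) (d : real_div_alg) :
  d <> RealAlg -> exists iota : real_div_alg_sort R d, iota * iota = -1.
Proof.
case: d => //= _.
  exists ('i%C : R[i]).
  by rewrite -[RHS]/(-1 : R[i]) -[LHS]/('i%C * 'i%C : R[i]) -expr2 sqr_i.
exists (Quat 0 1 0 0 : quaternion R).
rewrite -[LHS]/(quat_mul _ _) -[RHS]/(quat_opp (quat1 R)) /quat_mul /quat_opp /=.
by congr Quat; ring.
Qed.

Section Terwilliger.
Variables (R : rcfType) (X : finType) (e : rel X) (x : X).

Lemma terwilliger_complexify M :
  terwilliger R e x M -> terwilliger R[i] e x (map_mx (real_complex R) M).
Proof.
elim=> {M} [M [->|[i ->]]||M M' _ TM _ TM'|a M _ TM|M M' _ TM _ TM'].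
- apply: gen_subalg_gen; left; apply/matrixP => u v.
  by rewrite !mxE rmorph_nat.
- apply: gen_subalg_gen; right; exists i; apply/matrixP => u v.
  by rewrite !mxE rmorph_nat.
- by rewrite map_mx1; apply: gen_subalg1.
- by rewrite map_mxD; apply: gen_subalgD.
- by rewrite map_mxZ; apply: gen_subalgZ.
- by rewrite map_mxM; apply: gen_subalgM.
Qed.

(** The generators are real matrices, and T^R + i T^R is closed under complex scalars, sums and
    products. *)
Lemma terwilliger_split M : terwilliger R[i] e x M ->
  exists a b, [/\ terwilliger R e x a, terwilliger R e x b &
    M = map_mx (real_complex R) a + 'i%C *: map_mx (real_complex R) b].
Proof.
have [T1 T_lin T_mul] := gen_subalg_subalgebra (fun M => M = adjmx e R \/
  exists i : 'I_(diameter e).+1, M = dual_idem e R x i).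
have T0 := lin_closed0 T_lin.
have real_ok a M' : terwilliger R e x a -> M' = map_mx (real_complex R) a ->
  exists a' b', [/\ terwilliger R e x a', terwilliger R e x b' &
    M' = map_mx (real_complex R) a' + 'i%C *: map_mx (real_complex R) b'].
  by move=> Ta ->; exists a, 0; split=> //; rewrite map_mx0 scaler0 addr0.
elim=> {M} [M [->|[i ->]]||M M' _ [a [b [Ta Tb ->]]] _ [a' [b' [Ta' Tb' ->]]]|
  c M _ [a [b [Ta Tb ->]]]|M M' _ [a [b [Ta Tb ->]]] _ [a' [b' [Ta' Tb' ->]]]].
- apply: (real_ok (adjmx e R)); first by apply: gen_subalg_gen; left.
  by apply/matrixP => u v; rewrite !mxE rmorph_nat.
- apply: (real_ok (dual_idem e R x i)); first by apply: gen_subalg_gen; right; exists i.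
  by apply/matrixP => u v; rewrite !mxE rmorph_nat.
- by apply: (real_ok 1%:M); rewrite ?map_mx1.
- exists (a + a'), (b + b'); split; try exact: (lin_closedD T_lin).
  by rewrite !map_mxD scalerDr addrACA.
- exists (complex.Re c *: a - complex.Im c *: b), (complex.Im c *: a + complex.Re c *: b).
  split.
  + by apply: (lin_closedB T_lin); apply: (lin_closedZ T_lin).
  + by apply: (lin_closedD T_lin); apply: (lin_closedZ T_lin).
  apply/matrixP => u v; rewrite !mxE; case: c => s t /=; simpc.
  by congr (_ +i* _)%C; ring.
exists (a *m a' - b *m b'), (a *m b' + b *m a'); split.
- by apply: (lin_closedB T_lin); apply: T_mul.
- by apply: (lin_closedD T_lin); apply: T_mul.
rewrite map_mxB map_mxD !map_mxM mulmxDl !mulmxDr -!scalemxAl -!scalemxAr.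
rewrite scalerA -expr2 sqr_i scaleN1r scalerDr.
by rewrite [X in _ + X]addrC addrACA.
Qed.

End Terwilliger.

(** * Symmetric corners of the real Terwilliger algebra *)

Section TerwilligerBlock.
Variables (R : realFieldType) (X : finType) (e : rel X).
Hypothesis e_drg : distance_regular e.
Hypothesis D_gt0 : (0 < diameter e)%N.
Variable theta : 'I_(diameter e).+1 -> R.
Hypothesis theta_ord : eigenvalue_ordering theta.
Hypothesis E_Qpol : Q_polynomial (prim_idem theta).
Variable x : X.

Local Notation T := (terwilliger R e x).

Lemma terwilliger_subalgebra : subalgebra T.
Proof. exact: gen_subalg_subalgebra. Qed.

Lemma terwilliger_tr t : T t -> T t^T.
Proof.
apply: gen_subalg_tr => M [->|[i ->]]; first exact: adjmx_tr.
exact: dual_idem_tr.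
Qed.

Lemma terwilliger_dual_idem (i : 'I_(diameter e).+1) : T (dual_idem e R x i).
Proof. by apply: gen_subalg_gen; right; exists i. Qed.

Lemma terwilliger_prim_idem i : T (prim_idem theta i).
Proof.
have [T1 T_lin T_mul] := terwilliger_subalgebra.
have TA : T (adjmx e R) by apply: gen_subalg_gen; left.
rewrite prim_idemE //; apply: (lin_closed_sum T_lin) => k _.
apply: (lin_closedZ T_lin); elim: (k : nat) => [|k' IHk]; first exact: T1.
by rewrite exprS; apply: T_mul.
Qed.

(** The least r with E_r^* z nonzero is the endpoint of the block, and c = E_r^* z is the corner
    idempotent; such an r exists because the E_k^* sum to 1. *)
Lemma terwilliger_corner (z : 'M[R]_#|X|) : T z -> z != 0 -> z *m z = z ->
    z^T = z -> (forall t, T t -> z *m t = t *m z) ->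
  exists c, [/\ T c, c != 0, c *m c = c, c *m z = c &
    forall t, T t -> (c *m t *m c)^T = c *m t *m c].
Proof.
move=> Tz z_neq0 zz trz z_comm; have [_ _ T_mul] := terwilliger_subalgebra.
pose P (k : 'I_(diameter e).+1) := dual_idem e R x k *m z != 0.
have [k0 Pk0] : exists k, P k.
  apply/existsP; apply: contraNT z_neq0 => /existsPn none.
  rewrite -[z]mul1mx -(dual_idem_sum R e x) mulmx_suml big1 // => k _.
  by apply/eqP; have := none k; rewrite negbK.
have [r Pr r_min] := arg_minnP (fun k : 'I_(diameter e).+1 => k : nat) Pk0.
have dp := drg_dual_pair e_drg D_gt0 theta_ord E_Qpol x.
have z_idm c i : z *m drg_idem theta x c i = drg_idem theta x c i *m z.
  apply: z_comm; case: c; first exact: terwilliger_prim_idem.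
  exact: terwilliger_dual_idem.
have z_low (k : 'I_(diameter e).+1) : (k < r)%N -> drg_idem theta x false k *m z = 0.
  move=> k_lt; apply/eqP; apply: contraTT k_lt => Pk.
  by rewrite -leqNgt; apply: r_min.
exists (dual_idem e R x r *m z); split=> //.
- by apply: T_mul => //; apply: terwilliger_dual_idem.
- exact: (corner_idem dp z_idm zz erefl).
- by rewrite -mulmxA zz.
move=> t Tt; apply: (corner_gen_subalg_tr dp z_idm zz trz z_low erefl (A := adjmx e R))
  => //.
exact: drg_pw1.
Qed.

End TerwilligerBlock.

Theorem theorem1p5 (R : realType) (X : finType) (e : rel X)
    (e_drg : distance_regular e) (D_ge3 : (3 <= diameter e)%N)
    (theta : 'I_(diameter e).+1 -> R)
    (theta_ord : eigenvalue_ordering theta)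
    (E_Qpol : Q_polynomial (prim_idem theta))
    (x : X)
    (h : nat) (n : 'I_h -> nat)
    (h_gt0 : (0 < h)%N) (n_gt0 : forall i, (0 < n i)%N)
    (TC_iso : iso_mx_sum (terwilliger R[i] e x) n (fun _ => R[i]^o))
    (l : nat) (m : 'I_l -> nat) (d : 'I_l -> real_div_alg)
    (l_gt0 : (0 < l)%N) (m_gt0 : forall i, (0 < m i)%N)
    (TR_iso : iso_mx_sum (terwilliger R e x) m
                (fun i => real_div_alg_sort R (d i))) :
  l = h /\
  exists s : 'I_l -> 'I_h,
    bijective s /\ forall i, m i = n (s i) /\ d i = RealAlg.
Proof.
have D_gt0 : (0 < diameter e)%N by apply: leq_trans D_ge3.
have TR_alg := terwilliger_subalgebra R e x.
have TC_alg := gen_subalg_subalgebra (fun M => M = adjmx e R[i] \/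
  exists i : 'I_(diameter e).+1, M = dual_idem e R[i] x i).
have T_tr := @terwilliger_tr R X e e_drg x.
have [f f_iso] := TR_iso; have [g g_iso] := TC_iso.
have [z z_units] := block_units_exist f_iso.
have [w w_units] := block_units_exist g_iso.
have K_div i (b : real_div_alg_sort R (d i)) : b != 0 -> exists b', b' * b = 1.
  exact: real_div_alg_inv.
(* A division algebra other than [R] would contain a square root of -1, which the symmetric corner
   excludes. *)
have d_real i : d i = RealAlg.
  have [] : {d i = RealAlg} + {d i <> RealAlg} by case: (d i); [left | right | right].
    by [].
  move=> /real_div_alg_imaginary => /(_ R)[iota iota2].
  have Tz : terwilliger R e x (z i) by case: (z_units i) => -[].
  have [] := terwilliger_corner e_drg D_gt0 theta_ord E_Qpol Tz.
  - exact: (block_id_neq0 TR_alg f_iso z_units).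
  - exact: (block_id_idem TR_alg f_iso z_units).
  - exact: (block_id_tr TR_alg T_tr f_iso z_units m_gt0 K_div).
  - exact: (block_id_comm TR_alg f_iso z_units).
  move=> c [Tc c_neq0 cc cz cTc].
  by case: (block_no_imaginary TR_alg f_iso z_units K_div Tc c_neq0 cc cz cTc iota2).
have K1 i (b : real_div_alg_sort R (d i)) : exists a : R, b = a *: 1.
  move: (d_real i) b; case: (d i) => // _ b; exists b.
  by rewrite /GRing.scale /= mulr1.
have TR_cx := @terwilliger_complexify R X e x.
have TC_split := @terwilliger_split R X e x.
(* The complexified real units are exactly the complex units; s and s' record the matching in both
   directions. *)
have /fin_all_exists[s zs] := block_id_real_complex TR_alg TC_alg TR_cx TC_split
  f_iso m_gt0 K1 z_units g_iso n_gt0 w_units.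
have /fin_all_exists[s' ws'] := block_id_complex_real TR_alg TC_alg TR_cx TC_split
  f_iso m_gt0 K1 z_units g_iso n_gt0 w_units.
(* Units of different blocks are orthogonal and nonzero, so equal units have equal indices. *)
have z_inj i i' : map_mx (real_complex R) (z i) = map_mx (real_complex R) (z i') -> i = i'.
  move=> /map_mx_inj zz'; apply/eqP; apply: contraTT isT => i_neq.
  have := block_id_orth TR_alg f_iso z_units i_neq.
  rewrite -zz' (block_id_idem TR_alg f_iso z_units) => /eqP.
  by rewrite (negPf (block_id_neq0 TR_alg f_iso z_units (m_gt0 i))).
have w_inj j j' : w j = w j' -> j = j'.
  move=> ww'; apply/eqP; apply: contraTT isT => j_neq.
  have := block_id_orth TC_alg g_iso w_units j_neq.
  rewrite -ww' (block_id_mull TC_alg g_iso w_units); last by case: (w_units j).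
  by move/eqP; rewrite (negPf (block_id_neq0 TC_alg g_iso w_units (n_gt0 j))).
have s_bij : bijective s.
  exists s' => [i|j]; first by apply: z_inj; rewrite ws' -zs.
  by apply: w_inj; rewrite -zs ws'.
split; first by have := bij_eq_card s_bij; rewrite !card_ord.
exists s; split=> // i; split; last exact: d_real.
exact: (block_size_eq TR_alg TC_alg TR_cx TC_split f_iso K1 z_units g_iso w_units (zs i)).
Qed.
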